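(* Let $n,s\ge1$ be integers, let $\lambda$ be a partition with $k:=|\lambda|\le n$ and $\ell(\lambda)\le s$, let $\Lambda_{n,\lambda,s}=(n-k+\lambda_1,\dots,n-k+\lambda_s)$ and $K=|\Lambda_{n,\lambda,s}|=n+(n-k)(s-1)$. Let $\alpha=(1^n,K-n)$, let $\mathsf x$ be a nilpotent $K\times K$ complex matrix with $\mathrm{JT}(\mathsf x)=\Lambda_{n,\lambda,s}$, and let $t=t_1+\cdots+t_{n+1}$ be a nilpotent block diagonal matrix with block sizes $\alpha$, with $\mathrm{JT}(t_i)=(1)$ for $i\le n$ and $\mathrm{JT}(t_{n+1})=((n-k)^{s-1})$. Then the generalized Springer fiber $\mathscr P^{y}_{\mathsf x}$ is isomorphic to the $\Delta$-Springer variety: $\mathscr P_{\mathsf x}^{y}\cong Y_{n,\lambda,s}$.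
   Context: **Jordan type.** For a nilpotent endomorphism $z$, $\mathrm{JT}(z)$ is the partition of its Jordan block sizes; $(a^b)$ is the partition with $b$ parts equal to $a$; partitions are padded with zeros. **Borho-MacPherson setup.** $G=GL_K(\mathbb C)$, $\mathcal N$ is the variety of nilpotent $K\times K$ matrices, $\mathrm{Ad}(g)z=gzg^{-1}$. $P\subset G$ is the parabolic subgroup of invertible block upper triangular matrices with diagonal block sizes $\alpha$ (a final block of size $0$ is ignored), $L$ its Levi subgroup of invertible block diagonal matrices, $\mathcal N_L$ the set of nilpotent block diagonal matrices, $\mathfrak n$ the nilradical of $\mathrm{Lie}(P)$ (strictly block upper triangular matrices). $\widetilde{\mathcal N}^P=G\times_P(\mathcal N_L+\mathfrak n)$ is the quotient of the product by the $P$-action $p\cdot(g,z)=(gp^{-1},\mathrm{Ad}(p)z)$, and $\xi:\widetilde{\mathcal N}^P\to\mathcal N$ is $\xi(g,z)=\mathrm{Ad}(g)z$. For $t\in\mathcal N_L$ (with diagonal blocks $t_i$) let $\mathcal O_t=\mathrm{Ad}(L)t$, let $y=(1,t+u)\in\widetilde{\mathcal N}^P$ for arbitrary $u\in\mathfrak n$, and $\mathcal O_y=G\times_P(\mathcal O_t+\mathfrak n)$, whose closure is $\overline{\mathcal O}_y=G\times_P(\overline{\mathcal O}_t+\mathfrak n)$. The generalized Springer fiber is $\mathscr P^y_{\mathsf x}=\overline{\mathcal O}_y\cap\xi^{-1}(\mathsf x)$. **$\Delta$-Springer variety.** For $\mathsf x$ as in the claim, $Y_{n,\lambda,s}$ is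 the variety of partial flags $0=F_0\subset F_1\subset\cdots\subset F_n\subseteq F_{n+1}=\mathbb C^K$ with $\dim F_i=i$ for $i\le n$, $\mathsf xF_i\subseteq F_i$ for all $i$, and $F_n\supseteq\mathrm{im}(\mathsf x^{n-k})$. *)

(* Defs.v *)
From HB Require Import structures.
From mathcomp Require Import all_boot all_order all_algebra.
From mathcomp Require Import boolp classical_sets.
From mathcomp Require Import mpoly.

Set Implicit Arguments.
Unset Strict Implicit.
Unset Printing Implicit Defensive.

Import GRing.Theory.
Local Open Scope ring_scope.
Local Open Scope quotient_scope.
Local Open Scope classical_set_scope.

(* Varieties over k are presented as spaces with functions: a set of points,
   its Zariski open subsets, and the regular k-valued functions on each open
   subset.  A function that is regular on U is represented by any of its
   extensions to a function on all points; in every construction below,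
   [regular U f] depends only on the values of f on U. *)
Record space (k : Type) := Space {
  point :> Type;
  zopen : set (set point);
  regular : set point -> set (point -> k) }.

Section Spaces.
Variable k : fieldType.

Definition zclosure (X : space k) (A : set X) : set X :=
  [set x | forall U : set X, zopen U -> U x -> A `&` U !=set0].

Definition morphism (X Y : space k) (f : X -> Y) : Prop :=
  forall V : set Y, zopen V ->
    zopen (f @^-1` V) /\
    (forall h : Y -> k, regular V h -> regular (f @^-1` V) (h \o f)).

Definition isomorphic (X Y : space k) : Prop :=
  exists (f : X -> Y) (g : Y -> X),
    [/\ cancel f g, cancel g f, morphism f & morphism g].

(* A finite dimensional vector space as an affine space; the polynomial
   functions are the polynomials in the coordinates along a basis. *)
Definition peval (V : vectType k) (p : {mpoly k[\dim {:V}]}) (v : V) : k :=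
  p.@[fun i => coord (vbasis {:V}) i v].

Definition affine_open (V : vectType k) : set (set V) :=
  [set U | exists S : set {mpoly k[\dim {:V}]},
             U = [set v | exists2 p, S p & peval p v != 0]].

Definition affine_regular (V : vectType k) (U : set V) : set (V -> k) :=
  [set f | forall v, U v ->
     exists (W : set V) (p q : {mpoly k[\dim {:V}]}),
       [/\ affine_open W, W v, W `<=` U
         & forall w, W w -> peval q w != 0 /\ f w = peval p w / peval q w]].

Definition affine (V : vectType k) : space k :=
  Space (@affine_open V) (@affine_regular V).

(* The subvariety structure: on a subset A of X, the regular functions are
   those that extend locally to regular functions on open subsets of X. *)
Definition subspace (X : space k) (A : set X) : space k :=
  @Space k A
    [set U : set A | exists2 V : set X, zopen V & U = val @^-1` V]
    (fun U : set A => [set f : A -> k | forall a : A, U a ->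
       exists (V : set X) (h : X -> k),
         [/\ zopen V, V (val a), regular V h
           & forall b : A, U b -> V (val b) -> f b = h (val b)]]).

(* The quotient structure on T along a surjection q. *)
Definition quotient_space (X : space k) (T : Type) (q : X -> T) : space k :=
  @Space k T
    [set U : set T | zopen (q @^-1` U)]
    (fun U : set T => [set f : T -> k | regular (q @^-1` U) (f \o q)]).

End Spaces.

Arguments subspace {k} X A.

Section JordanType.
Variable k : fieldType.

Definition nilpotent (m : nat) (z : 'M[k]_m) : Prop := exists e : nat, z ^+ e = 0.

Definition Ad (m : nat) (g z : 'M[k]_m) : 'M[k]_m := g *m z *m invmx g.

Definition jordan_block (m : nat) : 'M[k]_m :=
  \matrix_(i, j) (j == i.+1 :> nat)%:R.

(* [jordan_type z mu] is JT(z) = mu; mu may be padded with zeros. *)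
Definition jordan_type (m : nat) (z : 'M[k]_m) (mu : seq nat) : Prop :=
  sorted geq mu /\
  exists (e : (\sum_(i < size mu) nth 0 mu i)%N = m) (g : 'M[k]_m),
    g \in unitmx /\
    Ad g z = castmx (e, e) (\mxdiag_(i < size mu) jordan_block (nth 0%N mu i)).

End JordanType.

(* By Cayley-Hamilton, the inverse of A is a polynomial in A. *)
Lemma invmx_closed (k : fieldType) (m : nat) (Q : 'M[k]_m -> Prop) (A : 'M[k]_m) :
  (forall c : k, Q c%:M) -> (forall B D, Q B -> Q D -> Q (B + D)) ->
  (forall B D, Q B -> Q D -> Q (B *m D)) ->
  A \in unitmx -> Q A -> Q (invmx A).
Proof.
case: m Q A => [|m] Q A Qc QD QM Au QA; first by rewrite [invmx A]flatmx0 -(flatmx0 0%:M).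
have Qh q : Q (horner_mx A q).
  elim/poly_ind: q => [|q c IH]; first by rewrite rmorph0; have := Qc 0; rewrite raddf0.
  by rewrite rmorphD rmorphM /= horner_mx_X horner_mx_C; apply: QD => //; apply: QM.
have := Cayley_Hamilton A.
set f := char_poly A.
have [q [c fE]] : exists q c, f = q * 'X + c%:P.
  by elim/poly_ind: f => [|q c _]; [exists 0, 0; rewrite mul0r addr0 | exists q, c].
have c0 : c != 0.
  have : f`_0 != 0 by rewrite /f char_poly_det mulf_neq0 ?signr_eq0 // -unitfE.
  by rewrite fE coefD coefMX coefC /= add0r.
rewrite fE rmorphD rmorphM /= horner_mx_X horner_mx_C => /eqP.
rewrite addr_eq0 => /eqP qA.
suff -> : invmx A = horner_mx A q *m (- c^-1)%:M by apply: QM.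
apply: (can_inj (mulmxK Au)); rewrite mulVmx // -mulmxA mul_scalar_mx -scalemxAr.
by rewrite [_ *m A]qA scaleNr scalerN opprK scale_scalar_mx mulVf.
Qed.

Lemma invmxM (k : fieldType) (m : nat) (g h : 'M[k]_m) :
  g \in unitmx -> h \in unitmx -> invmx (g *m h) = invmx h *m invmx g.
Proof.
move=> gU hU; have ghU : g *m h \in unitmx by rewrite unitmx_mul gU.
by apply: (can_inj (mulKmx ghU)); rewrite mulmxV // mulmxA mulmxK // mulmxV.
Qed.

Lemma AdM (k : fieldType) (m : nat) (g h z : 'M[k]_m) :
  g \in unitmx -> h \in unitmx -> Ad (g *m h) z = Ad g (Ad h z).
Proof. by move=> gU hU; rewrite /Ad invmxM // !mulmxA. Qed.

Section BorhoMacPherson.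
Variables (k : fieldType) (r : nat) (alpha : 'I_r -> nat).
Local Notation K := (\sum_i alpha i)%N.
Local Notation M := 'M[k]_K.
Implicit Types g p l t u z : M.

Definition block_upper p : Prop :=
  forall i j : 'I_r, (j < i)%N -> submxblock p i j = 0.

Definition block_diagonal p : Prop :=
  forall i j : 'I_r, i != j -> submxblock p i j = 0.

Definition parabolic : set M := [set p | p \in unitmx /\ block_upper p].
Definition levi : set M := [set l | l \in unitmx /\ block_diagonal l].
Definition levi_nilpotent : set M := [set t | block_diagonal t /\ nilpotent t].
Definition nilradical : set M :=
  [set u | forall i j : 'I_r, (j <= i)%N -> submxblock u i j = 0].
Definition levi_orbit t : set M := [set Ad l t | l in levi].

(* A + n *)
Definition plus_nilradical (A : set M) : set M :=
  [set w | exists t u, [/\ A t, nilradical u & w = t + u]].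

(* G x (N_L + n) *)
Definition pairs : set (M * M)%type :=
  [set gz | gz.1 \in unitmx /\ plus_nilradical levi_nilpotent gz.2].

Definition pairs_space : space k :=
  subspace (affine (M * M)%type) pairs.

(* The relation of lying in one orbit of p . (g, z) = (g p^-1, Ad(p) z). *)
Definition same_orbit (a b : pairs) : bool :=
  `[< exists2 p, parabolic p &
        val b = ((val a).1 *m invmx p, Ad p (val a).2) >].


Lemma block_upperP p : block_upper p <->
  (forall a b : 'I_K, (tagnat.sig1 b < tagnat.sig1 a)%N -> p a b = 0).
Proof.
split=> [H a b ltab | H i j ltij].
  have := congr1 (fun A : 'M_(_, _) => A (tagnat.sig2 a) (tagnat.sig2 b)) (H _ _ ltab).
  by rewrite !mxE !tagnat.sig2K.
by apply/matrixP => a b; rewrite !mxE H // !tagnat.Rank1K.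
Qed.

Lemma block_upperM p q : block_upper p -> block_upper q -> block_upper (p *m q).
Proof.
move=> /block_upperP Hp /block_upperP Hq; apply/block_upperP => a b ltab.
rewrite mxE big1 // => c _.
have [ltca|leac] := ltnP (tagnat.sig1 c) (tagnat.sig1 a).
  by rewrite Hp // mul0r.
by rewrite Hq ?mulr0 // (leq_trans ltab).
Qed.

Lemma block_upperD p q : block_upper p -> block_upper q -> block_upper (p + q).
Proof. by move=> Hp Hq i j ij; rewrite submxblockD Hp ?Hq ?addr0. Qed.

Lemma block_upper_scalar (c : k) : block_upper c%:M.
Proof.
apply/block_upperP => a b ltab; rewrite mxE.
by case: eqP ltab => // ->; rewrite ltnn.
Qed.

Lemma block_upperV p : p \in unitmx -> block_upper p -> block_upper (invmx p).
Proof.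
exact: (invmx_closed block_upper_scalar block_upperD block_upperM).
Qed.

Lemma same_orbit_refl : reflexive same_orbit.
Proof.
move=> a; apply/asboolP; exists 1%:M.
  by split; [exact: unitmx1 | exact: block_upper_scalar].
by rewrite /Ad invmx1 !mulmx1 mul1mx; case: (val a).
Qed.

Lemma same_orbit_sym : ssrbool.symmetric same_orbit.
Proof.
suff H a b : same_orbit a b -> same_orbit b a by move=> a b; apply/idP/idP; apply: H.
move=> /asboolP [p [pU Hp] Eb]; apply/asboolP; exists (invmx p).
  by split; [rewrite unitmx_inv | exact: block_upperV].
rewrite Eb /= invmxK mulmxKV // -AdM ?unitmx_inv // mulVmx //.
by rewrite /Ad invmx1 mulmx1 mul1mx; case: (val a).
Qed.

Lemma same_orbit_trans : transitive same_orbit.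
Proof.
move=> b a c /asboolP [p [pU Hp] Eb] /asboolP [q [qU Hq] Ec].
apply/asboolP; exists (q *m p).
  by split; [rewrite unitmx_mul qU | exact: block_upperM].
rewrite Ec Eb /= AdM //; congr (_, _).
by rewrite invmxM // mulmxA.
Qed.

Canonical same_orbit_equiv :=
  EquivRel same_orbit same_orbit_refl same_orbit_sym same_orbit_trans.

(* G x_P (N_L + n), with its quotient structure, and its map to N. *)
Definition twisted := {eq_quot same_orbit_equiv}.

Definition twisted_space : space k :=
  @quotient_space k pairs_space twisted (fun a : pairs => \pi_twisted a).

Definition xi (c : twisted) : M :=
  let gz := val (repr c) in Ad gz.1 gz.2.

Lemma xi_pi (a : pairs) : xi (\pi_twisted a) = Ad (val a).1 (val a).2.
Proof.
rewrite /xi; have /eqmodP/asboolP[p [pU _]] : repr (\pi_twisted a) = a %[mod twisted].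
  by rewrite reprK.
move=> ->; rewrite /= AdM ?unitmx_inv //; last first.
  by have [] := set_valP (repr (\pi_twisted a)).
rewrite -(@AdM _ _ (invmx p)) ?unitmx_inv // mulVmx //.
by rewrite [Ad 1%:M _]/Ad invmx1 mulmx1 mul1mx.
Qed.

(* O_y = G x_P (O_t + n) for y = (1, t + u); it does not depend on u in n. *)
Definition twisted_orbit t : set twisted :=
  [set \pi_twisted a | a in [set a : pairs | plus_nilradical (levi_orbit t) (val a).2]].

(* The closure of O_y intersected with the fiber of xi over x. *)
Definition springer_fiber t (x : M) : set twisted :=
  zclosure (X := twisted_space) (twisted_orbit t) `&` xi @^-1` [set x].

End BorhoMacPherson.


Section PartialFlags.
Variables (k : fieldType) (m n : nat).
Local Notation V := 'cV[k]_m.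

(* F_0, ..., F_n, F_(n+1) in k^m, the space of column vectors. *)
Definition flags : set {ffun 'I_n.+2 -> {vspace V}} :=
  [set F | [/\ F ord0 = 0%VS, F ord_max = fullv,
               (forall i j : 'I_n.+2, (i <= j)%N -> (F i <= F j)%VS)
             & (forall i : 'I_n.+2, (i <= n)%N -> \dim (F i) = i)]].

Definition frames : set 'M[k]_(m, n) := [set A | \rank A = n].

Definition frames_space : space k := subspace (affine 'M[k]_(m, n)) frames.

Definition span_columns (A : 'M[k]_(m, n)) : {ffun 'I_n.+2 -> {vspace V}} :=
  [ffun i : 'I_n.+2 =>
     if (i <= n)%N then <<take i [seq col j A | j : 'I_n]>>%VS else fullv].

Lemma free_columns (A : 'M[k]_(m, n)) : frames A -> free [seq col j A | j : 'I_n].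
Proof.
move=> rA; have fA : row_free A^T by rewrite /row_free mxrank_tr rA.
have sz : size [seq col j A | j : 'I_n] == n by rewrite size_map size_enum_ord.
apply/(@freeP _ _ _ (Tuple sz)) => c c0 i.
suff /rowP/(_ i) : \row_j c j = 0 :> 'rV[k]_n by rewrite !mxE.
apply: (row_free_inj fA); rewrite mul0mx; apply: trmx_inj.
rewrite trmx0 trmx_mul trmxK -[RHS]c0; apply/colP => a.
rewrite mxE summxE; apply: eq_bigr => j _.
rewrite !mxE /= (nth_map j) ?size_enum_ord // nth_ord_enum mulrC.
by rewrite mxE.
Qed.

Lemma span_columns_flag (A : frames) : flags (span_columns (val A)).
Proof.
have fA := free_columns (set_valP A); have sX : size [seq col j (val A) | j : 'I_n] = n by rewrite size_map size_enum_ord.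
split.
- by rewrite ffunE /= take0 span_nil.
- by rewrite ffunE /= ltnn.
- move=> i j ij; rewrite !ffunE; case: (leqP j n) => [jn|_]; last exact: subvf.
  rewrite (leq_trans ij jn); apply: sub_span => v.
  by rewrite -(take_takel _ ij); apply: mem_take.
- move=> i le_in; rewrite ffunE le_in.
  have /eqP-> : free (take i [seq col j (val A) | j : 'I_n]).
    by move: fA; rewrite -{1}(cat_take_drop i [seq _ | _ : _]) => /catl_free.
  by rewrite size_takel // sX.
Qed.

Definition flag_of (A : frames) : flags := SigSub (mem_set (span_columns_flag A)).

(* The partial flag variety, as the quotient of the variety of frames. *)
Definition flags_space : space k := @quotient_space k frames_space flags flag_of.

Definition mulv (x : 'M[k]_m) : 'End(V) := linfun (mulmx x).

(* Y_{n,lambda,s}, where e = n - |lambda|. *)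
Definition delta_springer (e : nat) (x : 'M[k]_m) : set flags :=
  [set F : flags |
     (forall i : 'I_n.+2, (mulv x @: val F i <= val F i)%VS) /\
     (limg (mulv (x ^+ e)) <= val F (inord n))%VS].

End PartialFlags.

Arguments delta_springer {k m} n e x.

Section Compositions.
Variables (n s : nat) (lambda : seq nat).

Definition is_partition (mu : seq nat) : Prop := sorted geq mu /\ 0%N \notin mu.

Definition Lambda : seq nat :=
  [seq (n - sumn lambda + nth 0 lambda i)%N | i <- iota 0 s].

(* The sequence of block sizes (1^n, K - n). *)
Definition alpha (K : nat) (i : 'I_n.+1) : nat := if (i < n)%N then 1%N else (K - n)%N.

Lemma sum_alpha (K : nat) : (n <= K)%N -> (\sum_i alpha K i)%N = K.
Proof.
move=> le_nK; rewrite big_ord_recr /= /alpha ltnn.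
under eq_bigr => i _ do rewrite /= ltn_ord.
by rewrite sum_nat_const card_ord muln1 subnKC.
Qed.

Lemma sumn_Lambda : (0 < s)%N -> (sumn lambda <= n)%N -> (size lambda <= s)%N ->
  sumn Lambda = (n + (n - sumn lambda) * (s - 1))%N.
Proof.
move=> s0 le_kn le_ls.
have -> : sumn Lambda = (s * (n - sumn lambda) + sumn lambda)%N.
  rewrite /Lambda sumnE big_map big_split /= big_const_seq count_predT size_iota.
  rewrite iter_addn_0 mulnC; congr (_ + _)%N.
  rewrite -[in RHS](mkseq_nth 0%N lambda) sumnE big_map.
  rewrite -{1}(subnKC le_ls) iotaD big_cat /= [X in (_ + X)%N]big1_seq ?addn0 //.
  by move=> i /andP[_]; rewrite mem_iota add0n => /andP[le_i _]; rewrite nth_default.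
by case: s s0 => // s' _; rewrite subn1 mulSn mulnC addnAC subnK.
Qed.

End Compositions.

Arguments alpha : clear implicits.

(* Main.v *)
Require Import Defs.
From mathcomp Require Import all_boot all_order all_algebra.
From mathcomp Require Import reals complex.
From mathcomp Require Import boolp classical_sets mpoly.
(* [space] is also a constant of MathComp. *)
Import Defs.

Set Implicit Arguments.
Unset Strict Implicit.
Unset Printing Implicit Defensive.

Import GRing.Theory Num.Theory.
Local Open Scope ring_scope.
Local Open Scope quotient_scope.
Local Open Scope classical_set_scope.

(**
A point [g, z] of the twisted product over x is determined by the flag spanned
by the first n columns of g: given that flag, g is unique up to P, and
z = g^-1 x g.  That z is block upper triangular means that x preserves the flag.
The fiber is cut out by the closure of O_t, that is, by the vanishing of the
e-th power of the last diagonal block of z (e = n - k, q = s - 1), which means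
that the image of x^e lies in F_n.

For the closure: if zeta^e = 0 in dimension e q, then zeta is strictly block
upper triangular for some flag with e steps of dimension q, and so is the whole
line joining zeta to a model D of Jordan type (e^q); the generic point of this
line satisfies N^e = 0 and rank N^(e-1) = q, hence is conjugate to D.

The map from the fiber to flags is induced by a linear map.  Its inverse is
regular because the projection from frames to flags has local sections: near a
flag spanned by the first columns of g0, the frame A has a unique
representative under column operations whose top part, in the basis g0, is lower
unitriangular, and its entries are rational functions of A by Cramer's rule. *)

(** * Spaces with functions *)

Section SpaceTheory.
Variable k : fieldType.
Implicit Types X Y Z : space k.

(** The record [space] imposes no axioms; these are the properties that the gluing arguments need,
    propagated below through each construction. In the last clause [O] may exceed [U], so gluing
    also yields restriction to smaller open sets. *)
Definition sheaf_like X : Prop :=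
  [/\ (forall U V : set X, zopen U -> zopen V -> zopen (U `&` V)),
      (forall C : set (set X), (forall U, C U -> zopen U) ->
         zopen [set x | exists2 U, C U & U x])
    & (forall (U : set X) (f : X -> k), zopen U ->
         (forall x, U x -> exists (O : set X) (h : X -> k),
            [/\ zopen O, O x, regular O h & forall y, U y -> O y -> f y = h y]) ->
         regular U f)].

Lemma regular_restrict X (U V : set X) (f : X -> k) : sheaf_like X ->
  zopen U -> zopen V -> regular V f -> regular (U `&` V) f.
Proof.
case=> HI _ Hg oU oV rf; apply: Hg; first exact: HI.
by move=> x [_ Vx]; exists V, f.
Qed.

Lemma affine_open_nonvanishing (V : vectType k) (p : {mpoly k[\dim {:V}]}) :
  affine_open [set v | peval p v != 0].
Proof.
exists [set p]; apply/seteqP; split=> v /=; first by exists p.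
by case=> ? ->.
Qed.

Lemma affine_openP (V : vectType k) (U : set V) : affine_open U <->
  forall v, U v -> exists2 p, peval p v != 0 & forall w, peval p w != 0 -> U w.
Proof.
split=> [[S ->] v /= [p Sp pv]|H]; first by exists p => // w pw; exists p.
exists [set p | forall w, peval p w != 0 -> U w].
apply/seteqP; split=> v /=.
  by move=> /H [p pv Hp]; exists p.
by case=> p; apply.
Qed.

Lemma affine_openI (V : vectType k) (U W : set V) :
  affine_open U -> affine_open W -> affine_open (U `&` W).
Proof.
move=> /affine_openP oU /affine_openP oW; apply/affine_openP => v [/oU[p pv Hp] /oW[q qv Hq]].
exists (p * q) => [|w]; rewrite /peval mevalM mulf_eq0 negb_or; first exact/andP.
by move=> /andP[? ?]; split; [exact: Hp|exact: Hq].
Qed.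

Lemma affine_sheaf_like (V : vectType k) : sheaf_like (affine V).
Proof.
split=> [||U f oU H v Uv]; first exact: affine_openI.
  move=> C HC; apply/affine_openP => v [U /[dup] CU /HC /affine_openP HU /HU[p pv Hp]].
  by exists p => // w /Hp; exists U.
have [O [h [oO Ov rh fh]]] := H v Uv.
have [W [p [q [oW Wv WO E]]]] := rh v Ov.
exists (W `&` U), p, q; split; first exact: affine_openI.
- by split.
- by move=> w [].
- by move=> w [Ww Uw]; have [? <-] := E w Ww; split=> //; apply: fh => //; exact: WO.
Qed.

Lemma subspace_sheaf_like X (A : set X) : sheaf_like X -> sheaf_like (subspace X A).
Proof.
move=> SX; case: (SX) => HI HU Hg; split=> [U V [U' oU ->] [V' oV ->]||U f oU H a Ua].
- by exists (U' `&` V') => //; exact: HI.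
- move=> C HC.
  (* Taking all ambient open sets whose trace belongs to [C] avoids choosing one for each member of
     [C]. *)
  exists [set x | exists2 W : set X, zopen W /\ C (val @^-1` W) & W x].
    by apply: HU => W [].
  apply/seteqP; split=> a /=.
    by case=> U /[dup] CU /HC [W oW UE] Ua; exists W; rewrite -?UE //; rewrite UE in Ua.
  by case=> W [_ CW] Wa; exists (val @^-1` W).
- have [_ [h [[V oV ->] Va rh fh]]] := H a Ua.
  have [W [h' [oW Wa rh' hh']]] := rh a Va.
  exists (V `&` W), h'; split; [exact: HI|by []|exact: regular_restrict|].
  by move=> b Ub [Vb Wb]; rewrite fh // hh'.
Qed.

Lemma quotient_sheaf_like X (T : Type) (q : X -> T) :
  sheaf_like X -> sheaf_like (quotient_space q).
Proof.
case=> HI HU Hg; split=> [U V||U f oU H].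
- exact: HI.
- move=> C HC; rewrite /= (_ : _ @^-1` _ =
    [set x | exists2 W, [set q @^-1` U | U in C] W & W x]).
    by apply: HU => W [U /HC oU <-].
  apply/seteqP; split=> x /= [].
    by move=> U CU Ux; exists (q @^-1` U) => //; exists U.
  by move=> _ [U CU <-]; exists U.
- apply: Hg => // x Ux; have [O [h [oO Ox rh fh]]] := H _ Ux.
  by exists (q @^-1` O), (h \o q); split=> // y Uy Oy /=; apply: fh.
Qed.

(** The restriction of [f] to [U] is a morphism, phrased with total functions. Values outside [U]
    are irrelevant, so a map built by arbitrary choices can be replaced on a chart by an explicit
    one. *)
Definition morphism_on X Y (U : set X) (f : X -> Y) : Prop :=
  forall V : set Y, zopen V ->
    zopen (U `&` f @^-1` V) /\
    (forall h : Y -> k, regular V h -> regular (U `&` f @^-1` V) (h \o f)).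

Lemma morphism_onT X Y (f : X -> Y) : morphism_on setT f <-> morphism f.
Proof. by split=> H V oV; have := H V oV; rewrite setTI. Qed.

Lemma morphism_on_comp X Y Z (U : set X) (f : X -> Y) (g : Y -> Z) :
  morphism_on U f -> morphism g -> morphism_on U (g \o f).
Proof.
move=> Hf Hg V /Hg [oV rV]; have [oU rU] := Hf _ oV; split=> // h /rV; exact: rU.
Qed.

Lemma morphism_on_quotient X Y (T : Type) (q : X -> T) (U : set T) (f : T -> Y) :
  morphism_on (q @^-1` U) (f \o q) -> morphism_on (X := quotient_space q) U f.
Proof. by []. Qed.

Lemma quotient_map_morphism X (T : Type) (q : X -> T) :
  morphism (Y := quotient_space q) q.
Proof. by move=> V oV; split=> // h. Qed.

Lemma morphism_on_subspace X Y (A U : set X) (f : X -> Y) :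
  morphism_on U f -> morphism_on (X := subspace X A) (val @^-1` U) (f \o val).
Proof.
move=> Hf V oV; have [oU rU] := Hf V oV; split; first by exists (U `&` f @^-1` V).
move=> h rh a aU; exists (U `&` f @^-1` V), (h \o f); split=> //; exact: rU.
Qed.

Lemma morphism_on_into_subspace X Y (B : set Y) (U : set X) (f : X -> B) :
  sheaf_like X -> morphism_on U (val \o f : X -> Y) ->
  morphism_on (Y := subspace Y B) U f.
Proof.
move=> [HI HU Hg] Hf _ [V oV ->]; split; first by have [] := Hf V oV.
move=> h rh; apply: Hg; first by have [] := Hf V oV.
move=> x [Ux Vx]; have [W [h' [oW Wx rh' hh']]] := rh _ Vx.
have [oUW rUW] := Hf _ oW.
exists (U `&` (val \o f) @^-1` W), (h' \o (val \o f)); split=> //; first exact: rUW.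
by move=> y [Uy Vy] [_ Wy] /=; apply: hh'.
Qed.

(** A preimage is the union of its open traces on the given neighborhoods, and the pulled-back
    functions glue. *)
Lemma morphism_local X Y (f : X -> Y) : sheaf_like X ->
  (forall x, exists U : set X, [/\ zopen U, U x & morphism_on U f]) -> morphism f.
Proof.
move=> [HI HU Hg] H V oV.
have oV' : zopen (f @^-1` V).
  rewrite (_ : f @^-1` V = [set x | exists2 W,
     zopen W /\ W `<=` f @^-1` V & W x]); first by apply: HU => W [].
  apply/seteqP; split=> x /=; last by case=> W [_]; apply.
  have [U [oU Ux Hf]] := H x; move=> Vx; exists (U `&` f @^-1` V) => //.
  by split; [have [] := Hf V oV|move=> ? []].
split=> // h rh; apply: Hg => // x Vx.
have [U [oU Ux Hf]] := H x; have [oUV rUV] := Hf V oV.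
by exists (U `&` f @^-1` V), (h \o f); split=> //; exact: rUV.
Qed.

Lemma morphism_on_ext X Y (U : set X) (f g : X -> Y) : sheaf_like X ->
  (forall x, U x -> f x = g x) -> morphism_on U f -> morphism_on U g.
Proof.
move=> [_ _ Hg] fg Hf W oW; have [oU rU] := Hf W oW.
have -> : U `&` g @^-1` W = U `&` f @^-1` W.
  by apply/seteqP; split=> x [Ux Wx]; split=> //; rewrite /= ?fg // -fg.
split=> // h rh; apply: Hg => // x [Ux Wx].
exists (U `&` f @^-1` W), (h \o f); split=> //; first exact: rU.
by move=> y [Uy _] _; rewrite /= fg.
Qed.

End SpaceTheory.

(** * Regular maps between affine spaces *)

Lemma scalar_morph (k : fieldType) (V : lmodType k) (f : V -> k) : scalar f ->
  [/\ {morph f : u v / u + v}, f 0 = 0 & forall a u, f (a *: u) = a * f u].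
Proof.
move=> fS; have fD : {morph f : u v / u + v}.
  by move=> u v; have := fS 1 u v; rewrite scale1r mul1r.
have f0 : f 0 = 0 by apply: (addrI (f 0)); rewrite -fD !addr0.
by split=> // a u; have := fS a u 0; rewrite !addr0 f0 addr0.
Qed.

Lemma affine_openT (k : fieldType) (V : vectType k) : affine_open [set: V].
Proof. by apply/affine_openP => v _; exists 1; rewrite // /peval meval1 oner_neq0. Qed.

Section AffineRegular.
Variables (k : fieldType) (V : vectType k).
Implicit Types (O : set V) (f g : V -> k).

Lemma affine_regular_ext O f g : (forall v, O v -> f v = g v) ->
  affine_regular O f -> affine_regular O g.
Proof.
move=> fg rf v Ov; have [W [p [q [oW Wv sW E]]]] := rf v Ov.
exists W, p, q; split=> // w Ww; have [q0 <-] := E w Ww.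
by rewrite fg //; exact: sW.
Qed.

Lemma affine_regular_poly O p : affine_open O -> affine_regular O (peval p).
Proof.
move=> oO v Ov; exists O, p, 1; split=> // w _.
by rewrite /peval meval1 oner_neq0 divr1.
Qed.

Lemma affine_regular_const O (c : k) : affine_open O -> affine_regular O (fun=> c).
Proof.
move=> oO; apply: (@affine_regular_ext _ (peval c%:MP)); last exact: affine_regular_poly.
by move=> v _; rewrite /peval mevalC.
Qed.

Lemma affine_regular_linear O f : affine_open O -> scalar f -> affine_regular O f.
Proof.
move=> oO /scalar_morph [fD f0 fZ]; pose b := vbasis {:V}.
apply: (@affine_regular_ext _ (peval (\sum_(i < \dim {:V}) (f b`_i) *: 'X_i))).
  move=> v _; rewrite /peval raddf_sum /=.
  rewrite [in RHS](coord_vbasis (memvf v)) (big_morph f fD f0).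
  by apply: eq_bigr => i _; rewrite mevalZ mevalXU fZ mulrC.
exact: affine_regular_poly.
Qed.

Lemma affine_regularD O f g : affine_regular O f -> affine_regular O g ->
  affine_regular O (fun v => f v + g v).
Proof.
move=> rf rg v Ov.
have [W [p [q [oW Wv sW E]]]] := rf v Ov; have [W' [p' [q' [oW' Wv' sW' E']]]] := rg v Ov.
exists (W `&` W'), (p * q' + p' * q), (q * q'); split; first exact: affine_openI.
- by split.
- by move=> w [/sW].
- move=> w [/E[q0 ->] /E'[q0' ->]]; rewrite /peval !(mevalM, mevalD) in q0 q0' *.
  by rewrite mulf_neq0 // addf_div.
Qed.

Lemma affine_regularM O f g : affine_regular O f -> affine_regular O g ->
  affine_regular O (fun v => f v * g v).
Proof.
move=> rf rg v Ov.
have [W [p [q [oW Wv sW E]]]] := rf v Ov; have [W' [p' [q' [oW' Wv' sW' E']]]] := rg v Ov.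
exists (W `&` W'), (p * p'), (q * q'); split; first exact: affine_openI.
- by split.
- by move=> w [/sW].
- move=> w [/E[q0 ->] /E'[q0' ->]]; rewrite /peval !mevalM in q0 q0' *.
  by rewrite mulf_neq0 // mulf_div.
Qed.

Lemma affine_open_neq0 O f : affine_open O -> affine_regular O f ->
  affine_open [set v | O v /\ f v != 0].
Proof.
move=> oO rf; apply/affine_openP => v [Ov fv].
have [W [p [q [oW Wv sW E]]]] := rf v Ov.
have /affine_openP/(_ v)[] := affine_openI oW (affine_open_nonvanishing p).
  by split=> //=; apply: contraNneq fv => p0; have [_ ->] := E v Wv; rewrite p0 mul0r.
move=> r rv Hr; exists r => // w /Hr [Ww pw]; split; first exact: sW.
by have [q0 ->] := E w Ww; rewrite mulf_neq0 ?invr_eq0.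
Qed.

Lemma affine_regularV O f : affine_open O -> affine_regular O f ->
  (forall v, O v -> f v != 0) -> affine_regular O (fun v => (f v)^-1).
Proof.
move=> oO rf f0 v Ov.
have [W [p [q [oW Wv sW E]]]] := rf v Ov; exists W, q, p; split=> // w Ww.
have := f0 w (sW w Ww); have [q0 ->] := E w Ww.
by rewrite mulf_eq0 negb_or invr_eq0 => /andP[-> _]; rewrite invf_div.
Qed.

Lemma affine_regular_sum O (I : finType) (P : pred I) (F : I -> V -> k) :
  affine_open O -> (forall i, affine_regular O (F i)) ->
  affine_regular O (fun v => \sum_(i | P i) F i v).
Proof.
move=> oO rF; elim: (index_enum I) => [|i s IH].
  by apply: affine_regular_ext (affine_regular_const 0 oO) => v _; rewrite big_nil.
by case Pi: (P i); [apply: affine_regular_ext (affine_regularD (rF i) IH)|apply: affine_regular_ext IH]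
  => v _; rewrite big_cons Pi.
Qed.

Lemma affine_regular_prod O (I : finType) (P : pred I) (F : I -> V -> k) :
  affine_open O -> (forall i, affine_regular O (F i)) ->
  affine_regular O (fun v => \prod_(i | P i) F i v).
Proof.
move=> oO rF; elim: (index_enum I) => [|i s IH].
  by apply: affine_regular_ext (affine_regular_const 1 oO) => v _; rewrite big_nil.
by case Pi: (P i); [apply: affine_regular_ext (affine_regularM (rF i) IH)|apply: affine_regular_ext IH]
  => v _; rewrite big_cons Pi.
Qed.

Definition regular_mx O (p q : nat) (F : V -> 'M[k]_(p, q)) : Prop :=
  forall i j, affine_regular O (fun v => F v i j).

Lemma regular_mx_const O p q (A : 'M[k]_(p, q)) : affine_open O ->
  regular_mx O (fun=> A).
Proof. by move=> oO i j; exact: affine_regular_const. Qed.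

Lemma regular_mxM O p q r (F : V -> 'M[k]_(p, q)) (G : V -> 'M[k]_(q, r)) :
  affine_open O -> regular_mx O F -> regular_mx O G ->
  regular_mx O (fun v => F v *m G v).
Proof.
move=> oO rF rG i j.
apply: (@affine_regular_ext _ (fun v => \sum_l F v i l * G v l j)) => [v _|].
  by rewrite mxE.
by apply: affine_regular_sum => // l; exact: affine_regularM.
Qed.

Lemma regular_mxX O p (F : V -> 'M[k]_p) e :
  affine_open O -> regular_mx O F -> regular_mx O (fun v => F v ^+ e).
Proof.
move=> oO rF; elim: e => [|e IH]; first exact: regular_mx_const.
move=> i j; apply: (@affine_regular_ext _ (fun v => (F v *m F v ^+ e) i j)) => [v _|].
  by rewrite exprS.
exact: regular_mxM.
Qed.

Lemma regular_det O p (F : V -> 'M[k]_p) :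
  affine_open O -> regular_mx O F -> affine_regular O (fun v => \det (F v)).
Proof.
move=> oO rF; rewrite /determinant; apply: affine_regular_sum => // s.
apply: affine_regularM; first exact: affine_regular_const.
exact: affine_regular_prod.
Qed.

(** The adjugate formula writes each entry of the inverse as a cofactor divided by the
    determinant. *)
Lemma regular_invmx O p (F : V -> 'M[k]_p) : affine_open O -> regular_mx O F ->
  (forall v, O v -> F v \in unitmx) -> regular_mx O (fun v => invmx (F v)).
Proof.
move=> oO rF uF i j.
apply: (@affine_regular_ext _ (fun v => (\det (F v))^-1 *
    ((-1) ^+ (j + i) * \det (row' j (col' i (F v)))))) => [v Ov|].
  by rewrite /invmx uF // !mxE.
apply: affine_regularM.
  apply: affine_regularV => // [|v Ov]; first exact: regular_det.
  by rewrite -unitfE; exact: uF.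
apply: affine_regularM; first exact: affine_regular_const.
apply: regular_det => // a b.
by apply: affine_regular_ext (rF (lift j a) (lift i b)) => v _; rewrite !mxE.
Qed.

(** Linear forms suffice as tests: coordinates generate the polynomials, and regular functions are
    locally quotients of polynomials. *)
Lemma regular_morphism_on (V' : vectType k) O (F : V -> V') : affine_open O ->
  (forall f : V' -> k, scalar f -> affine_regular O (f \o F)) ->
  morphism_on (X := affine V) (Y := affine V') O F.
Proof.
move=> oO rF.
have rp p : affine_regular O (peval p \o F).
  elim/mpolyind: p => [|c mm p _ _ rp].
    apply: affine_regular_ext (affine_regular_const 0 oO) => v _.
    by rewrite /peval /= meval0.
  apply: (@affine_regular_ext _ (fun v => c * (\prod_i
     (\prod_(j < mm i) (coord (vbasis {:V'}) i (F v)))) + peval p (F v))).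
    move=> v _; rewrite /peval /= mevalD mevalZ mevalX; congr (_ * _ + _).
    by apply: eq_bigr => i _; rewrite prodr_const card_ord.
  apply: affine_regularD => //; apply: affine_regularM; first exact: affine_regular_const.
  apply: affine_regular_prod => // i; apply: affine_regular_prod => // j.
  by apply: rF; move=> a u w; rewrite linearP.
have oF W : affine_open W -> affine_open (O `&` F @^-1` W).
  move=> /affine_openP oW; apply/affine_openP => v [Ov /oW [p pv Hp]].
  have /affine_openP/(_ v)[] := affine_open_neq0 oO (rp p); first by split.
  by move=> q qv Hq; exists q => // w /Hq[Ow /Hp].
move=> W oW; split; first exact: oF.
move=> h rh; have [_ _ Hg] := affine_sheaf_like V; apply: Hg; first exact: oF.
move=> v [Ov Wv]; have [W' [p [q [oW' W'v sW' E]]]] := rh _ Wv.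
exists (O `&` F @^-1` W'), (fun v => peval p (F v) / peval q (F v)); split=> //.
- exact: oF.
- have restr f : affine_regular O f -> affine_regular (O `&` F @^-1` W') f.
    move=> rf; rewrite -[O in O `&` _]setIid setIAC.
    by apply: (@regular_restrict _ (affine V)) => //; [exact: affine_sheaf_like|exact: oF].
  apply: affine_regularM; first exact/restr/rp.
  apply: affine_regularV; [exact: oF|exact/restr/rp|].
  by move=> w [_ /E[]].
- by move=> w [Ow Ww] [_ W'w] /=; have [_ <-] := E _ W'w.
Qed.

End AffineRegular.

(** * Nilpotent matrices of rectangular Jordan type *)

Section Conjugation.
Variable k : fieldType.

Lemma Ad_exp (m : nat) (g z : 'M[k]_m) e : g \in unitmx -> Ad g z ^+ e = Ad g (z ^+ e).
Proof.
move=> gU; elim: e => [|e IH]; first by rewrite !expr0 /Ad mulmx1 mulmxV.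
by rewrite !exprS IH -!mulmxE /Ad !mulmxA mulmxKV.
Qed.

Lemma Ad_linear (m : nat) (g z w : 'M[k]_m) (a b : k) :
  Ad g (a *: z + b *: w) = a *: Ad g z + b *: Ad g w.
Proof. by rewrite /Ad mulmxDr mulmxDl -!scalemxAr -!scalemxAl. Qed.

Lemma Ad0 (m : nat) (g : 'M[k]_m) : Ad g 0 = 0.
Proof. by rewrite /Ad mulmx0 mul0mx. Qed.

Lemma AdK (m : nat) (g z : 'M[k]_m) : g \in unitmx -> Ad (invmx g) (Ad g z) = z.
Proof. by move=> gU; rewrite -AdM ?unitmx_inv // mulVmx // /Ad invmx1 mul1mx mulmx1. Qed.

Lemma AdKV (m : nat) (g z : 'M[k]_m) : g \in unitmx -> Ad g (Ad (invmx g) z) = z.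
Proof. by move=> gU; rewrite -AdM ?unitmx_inv // mulmxV // /Ad invmx1 mul1mx mulmx1. Qed.

Lemma block_exp (q d : nat) (A : 'M[k]_(d, q)) (Z : 'M[k]_d) e :
  block_mx 0 0 A Z ^+ e.+1 = block_mx 0 0 (Z ^+ e *m A) (Z ^+ e.+1) :> 'M_(q + d).
Proof.
elim: e => [|e IH]; first by rewrite !expr1 expr0 mul1mx.
rewrite exprS IH -mulmxE mulmx_block !mul0mx !mulmx0 !addr0 !add0r mulmxA.
by rewrite mulmxE -!exprS.
Qed.

(** The map sending the rows of [U] to those of [A] is injective on the row space of [U], hence
    extends to an automorphism. The matrix [U^T *m A] is one extension, possibly singular, which
    [complete_unitmx] replaces by an invertible one. *)
Lemma complete_rows (m n : nat) (A : 'M[k]_(m, n)) (U : 'M[k]_(m, n)) :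
  row_free A -> U *m U^T = 1%:M -> exists2 g : 'M[k]_n, g \in unitmx & U *m g = A.
Proof.
move=> /eqP rA UU.
have UfA : U *m (U^T *m A) = A by rewrite mulmxA UU mul1mx.
have [|g gU Eg] := @complete_unitmx _ _ _ U (U^T *m A); last by exists g; rewrite // -Eg.
rewrite UfA rA; apply/esym/eqP; rewrite eqn_leq rank_leq_row /=.
have := mxrankM_maxl U U^T; by rewrite UU mxrank1.
Qed.

End Conjugation.

Section RectangularOrbit.
Variable k : fieldType.

(** Rows of [B] outside the current space are added one at a time, each raising the rank by exactly
    one. *)
Lemma intermediate_rowspace (d r : nat) (A B : 'M[k]_d) : (A <= B)%MS ->
  (\rank A + r <= \rank B)%N ->
  exists V : 'M[k]_d, [/\ \rank V = (\rank A + r)%N, (A <= V)%MS & (V <= B)%MS].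
Proof.
elim: r A => [|r IH] A AB rAB; first by exists A; rewrite addn0.
have /row_subPn [i Bi] : ~~ (B <= A)%MS.
  apply/negP => BA; have := mxrankS BA.
  by rewrite leqNgt (leq_trans _ rAB) // addnS ltnS leq_addr.
have A'B : (A + row i B <= B)%MS by rewrite addsmx_sub AB row_sub.
have rA' : \rank (A + row i B)%MS = (\rank A).+1.
  apply/eqP; rewrite eqn_leq; apply/andP; split.
    by rewrite (leq_trans (mxrank_adds_leqif _ _)) // -[leqRHS]addn1 leq_add2l rank_leq_row.
  rewrite ltn_neqAle mxrankS ?addsmxSl // andbT.
  by rewrite (mxrank_leqif_sup (addsmxSl _ _)) addsmx_sub submx_refl.
have [|V [rV AV VB]] := IH _ A'B; first by rewrite rA' addSnnS.
exists V; split=> //; first by rewrite rV rA' addSnnS.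
exact: submx_trans (addsmxSl _ _) AV.
Qed.

(** The rank drop from [z ^+ i] to [z ^+ i.+1] is the dimension of the intersection of the image of
    [z ^+ i] with the kernel of [z]. For [i <= e] it is at least the rank of [z ^+ e] and at most
    the dimension of the kernel, and the [e.+1] drops add up to [e.+1 * q]. *)
Lemma nilpotent_rank_bounds (d e q : nat) (z : 'M[k]_d) : d = (e.+1 * q)%N ->
  z ^+ e.+1 = 0 -> (\rank (z ^+ e) <= q <= \rank (kermx z))%N.
Proof.
move=> dE z0.
have step i : (\rank (z ^+ i.+1) + \rank (z ^+ i :&: kermx z)%MS)%N = \rank (z ^+ i).
  by rewrite exprSr -mulmxE mxrank_mul_ker.
have rank0 : \rank (z ^+ 0) = (e.+1 * q)%N by rewrite expr0 mxrank1.
apply/andP; split.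
  have low j : (j <= e.+1)%N -> (j * \rank (z ^+ e) <= \rank (z ^+ (e.+1 - j)))%N.
    elim: j => // j IH lt_je; rewrite subSS.
    have {IH} := IH (ltnW lt_je); rewrite subSn // => IH.
    rewrite -(step (e - j)%N) mulSn addnC leq_add //.
    apply: mxrankS; rewrite sub_capmx; apply/andP; split.
      by rewrite -{1}(subnK (leq_subr j e)) exprD -mulmxE submxMl.
    by rewrite sub_kermx mulmxE -exprSr z0.
  by have := low e.+1 (leqnn _); rewrite subnn rank0 leq_pmul2l.
have up i : (e.+1 * q <= \rank (z ^+ i) + i * \rank (kermx z))%N.
  elim: i => [|i IH]; first by rewrite rank0 leq_addr.
  apply: (leq_trans IH); rewrite -(step i) mulSn addnA leq_add2r leq_add2l.
  exact: mxrankS (capmxSr _ _).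
by have := up e.+1; rewrite z0 mxrank0 add0n leq_pmul2l.
Qed.

(* Such a [z] is strictly block triangular, with blocks of size q, in a
   suitable basis; [D] is the model nilpotent for the same flag, and [Y], [X]
   certify that [D ^+ e] has rank q. *)
Lemma nilpotent_direction (e q d : nat) (z : 'M[k]_d) : d = (e.+1 * q)%N ->
  z ^+ e.+1 = 0 ->
  exists (D : 'M[k]_d) (Y : 'M[k]_(q, d)) (X : 'M[k]_(d, q)),
    (forall a b, (a *: z + b *: D) ^+ e.+1 = 0) /\ Y *m D ^+ e *m X = 1%:M.
Proof.
elim: e d z => [|e IH] d z.
  rewrite mul1n => dE; subst d; rewrite expr1 => ->; exists 0, 1%:M, 1%:M; split.
    by move=> a b; rewrite !scaler0 addr0 expr1.
  by rewrite expr0 !mul1mx.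
move=> dE z0; have /andP[rz rk] := nilpotent_rank_bounds dE z0.
(* This space of dimension [q] is the first step of the flag: [z] kills it, and [z ^+ e.+1] vanishes
   on the quotient, to which the induction hypothesis applies. *)
have [||V0 [rV zV Vk]] := @intermediate_rowspace d (q - \rank (z ^+ e.+1)) (z ^+ e.+1) (kermx z).
- by rewrite sub_kermx mulmxE -exprSr z0.
- by rewrite subnKC.
rewrite subnKC // in rV.
have {V0 rV zV Vk} [V [fV zV Vz]] : exists V : 'M[k]_(q, d),
    [/\ row_free V, (z ^+ e.+1 <= V)%MS & V *m z = 0].
  clear -rV zV Vk; subst q; exists (row_base V0); split; first exact: row_base_free.
    by rewrite eq_row_base.
  by apply/eqP; rewrite -sub_kermx eq_row_base.
rewrite mulSn in dE; set d' := (e.+1 * q)%N in dE; subst d.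
pose U : 'M[k]_(q, q + d') := row_mx 1%:M 0.
have UU : U *m U^T = 1%:M by rewrite tr_row_mx mul_row_col trmx1 mulmx1 mul0mx addr0.
have [g gU gV] := complete_rows fV UU.
pose w := Ad g z.
(* In a basis starting with the rows of [V], the first [q] rows of the matrix vanish because
   [V *m z = 0]. *)
have wE : w = block_mx 0 0 (dlsubmx w) (drsubmx w).
  have : U *m w = 0 by rewrite /w /Ad !mulmxA gV Vz mul0mx.
  rewrite -{1 2}[w]submxK mul_row_block !mul0mx !addr0 !mul1mx => /eqP.
  by rewrite row_mx_eq0 => /andP[/eqP-> /eqP->].
set A := dlsubmx w in wE; set z' := drsubmx w in wE.
have z'0 : z' ^+ e.+1 = 0.
  have [T ET] := submxP zV.
  have : rsubmx (w ^+ e.+1) = 0.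
    rewrite Ad_exp // ET -gV /Ad -!mulmxA (mulmxA U) mulmxK //.
    by rewrite /U !mul_mx_row !mulmx0 row_mxKr.
  rewrite wE block_exp => /(congr1 (@dsubmx _ _ _ _)).
  by rewrite -[rsubmx _]/(rsubmx (block_mx _ _ _ _)) block_mxEh row_mxKr col_mxKd linear0.
have [D' [Y' [X' [H1 H2]]]] := IH _ _ erefl z'0.
have zE : z = Ad (invmx g) w by rewrite AdK.
(* By [block_exp], the power [e.+1] of the new model has lower left block [D' ^+ e *m X'], which
   [Y'] multiplies to the identity. The factors [g] undo the change of basis. *)
exists (Ad (invmx g) (block_mx 0 0 X' D')), (row_mx 0 Y' *m g), (invmx g *m col_mx 1%:M 0).
split=> [a b|].
  rewrite zE -Ad_linear Ad_exp ?unitmx_inv // wE !scale_block_mx !scaler0.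
  by rewrite add_block_mx !addr0 block_exp H1 exprS H1 mulr0 mul0mx block_mx0 Ad0.
rewrite Ad_exp ?unitmx_inv // /Ad invmxK.
rewrite !mulmxA !mulmxK // block_exp.
by rewrite mul_row_block !mul0mx !add0r mul_row_col mulmx1 mulmx0 addr0 mulmxA.
Qed.

(** The rows of [Y], [Y *m N], ..., [Y *m N ^+ e] form [q] Jordan chains of length [e.+1].
    Independence comes from the rows of [Y *m N ^+ e], which are independent because
    [Y *m N ^+ e *m X] is invertible; the number of rows equals the dimension. *)
Lemma nilpotent_jordan_form (e q d : nat) (N : 'M[k]_d) (t : 'M[k]_d)
    (Y : 'M[k]_(q, d)) (X : 'M[k]_(d, q)) :
  jordan_type t (nseq q e.+1) -> N ^+ e.+1 = 0 -> Y *m N ^+ e *m X \in unitmx ->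
  exists2 h : 'M[k]_d, h \in unitmx & N = Ad h t.
Proof.
move=> [_]; set mu := nseq q e.+1; case=> sE [g [gU tE]] N0 YX.
suff [B BU BE] : exists2 B : 'M[k]_d, B \in unitmx & Ad B N =
    castmx (sE, sE) (\mxdiag_(i < size mu) jordan_block k (nth 0%N mu i)).
  exists (invmx B *m g); first by rewrite unitmx_mul unitmx_inv BU.
  by rewrite AdM ?unitmx_inv // tE -BE AdK.
clear t g gU tE; case: _ / sE N N0 Y X YX => N N0 Y X YX; rewrite castmx_id.
have szq : size mu = q by rewrite size_nseq.
have muE (i : 'I_(size mu)) : nth 0%N mu i = e.+1 by rewrite nth_nseq -szq ltn_ord.
pose C (i : 'I_(size mu)) : 'M[k]_(nth 0%N mu i, _) :=
  \matrix_(a, j) (Y *m N ^+ a) (cast_ord szq i) j.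
pose B := \mxcol_i C i.
have BN : B *m N = \mxdiag_(i < size mu) jordan_block k (nth 0%N mu i) *m B.
  rewrite mxcol_mul mul_mxdiag_mxcol; apply/eq_mxcol => i; apply/matrixP => a j.
  have -> : (C i *m N) a j = (Y *m N ^+ a.+1) (cast_ord szq i) j.
    by rewrite exprSr -mulmxE mulmxA !mxE; apply: eq_bigr => l _; rewrite mxE.
  rewrite [RHS]mxE.
  (* Inside a chain [N] shifts to the next row; at its end the result is zero since
     [N ^+ e.+1 = 0]. *)
  have [lt_a|ge_a] := ltnP a.+1 (nth 0%N mu i).
    rewrite (bigD1 (Ordinal lt_a)) //= [X in _ + X]big1 ?addr0 => [|b nb].
      by rewrite [jordan_block _ _ _ _]mxE [C _ _ _]mxE /= eqxx mul1r.
    by rewrite mxE (negbTE (_ : b != a.+1 :> nat)) ?mul0r.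
  rewrite [RHS]big1 => [|b _].
    have -> : a.+1 = e.+1 by apply/eqP; rewrite eqn_leq -{2}(muE i) ge_a -(muE i) ltn_ord.
    by rewrite N0 mulmx0 mxE.
  rewrite mxE (negbTE (_ : b != a.+1 :> nat)) ?mul0r //.
  by rewrite neq_ltn (leq_trans (ltn_ord b) ge_a).
have BU : B \in unitmx.
  rewrite -row_free_unit -kermx_eq0; apply/rowV0P => v /sub_kermxP vB.
  apply/eqP; apply: contraT => /rV0Pn [s0' vs0'].
  (* In a relation [v] among the rows, [a] is the lowest level with a nonzero coefficient.
     Multiplying by [N ^+ (e - a)] kills all higher levels and leaves a relation [w] among the rows
     of [Y *m N ^+ e]. *)
  have [s0 vs0 min_s0] := @arg_minnP _ s0' (fun s => v 0 s != 0) (fun s => tagnat.sig2 s) vs0'.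
  set a := nat_of_ord (tagnat.sig2 s0) in min_s0.
  have le_ae : (a <= e)%N by rewrite -ltnS -(muE (tagnat.sig1 s0)) ltn_ord.
  pose w : 'rV[k]_q := \row_i \sum_(s | (cast_ord szq (tagnat.sig1 s) == i)
     && (tagnat.sig2 s == a :> nat)) v 0 s.
  have w0 : w = 0.
    suff wY : w *m (Y *m N ^+ e) = 0.
      by apply: (can_inj (mulmxK YX)); rewrite mul0mx !mulmxA in wY *; rewrite wY mul0mx.
    have <- : v *m (B *m N ^+ (e - a)) = 0 by rewrite mulmxA vB mul0mx.
    apply/rowP => j; rewrite [LHS]mxE [RHS]mxE.
    rewrite [LHS](eq_bigr (fun i => \sum_(s | (cast_ord szq (tagnat.sig1 s) == i) &&
      (tagnat.sig2 s == a :> nat)) v 0 s * (Y *m N ^+ e) i j)); last first.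
      by move=> i _; rewrite [w _ _]mxE mulr_suml.
    rewrite [LHS](exchange_big_dep xpredT) //=; apply: eq_bigr => s _.
    have -> : (B *m N ^+ (e - a)) s j =
        (Y *m N ^+ (tagnat.sig2 s + (e - a))) (cast_ord szq (tagnat.sig1 s)) j.
      rewrite mxcol_mul mxE exprD -mulmxE mulmxA !mxE.
      by apply: eq_bigr => l _; rewrite mxE.
    have [sa|nsa] := eqVneq (tagnat.sig2 s : nat) a.
      rewrite (big_pred1 (cast_ord szq (tagnat.sig1 s))) => [|i].
        by rewrite sa subnKC.
      by rewrite andbT eq_sym.
    rewrite big_pred0 => [|i]; last by rewrite andbF.
    have [->|/min_s0 le_as] := eqVneq (v 0 s) 0; first by rewrite mul0r.
    have lt_as : (a < tagnat.sig2 s)%N by rewrite ltn_neqAle eq_sym nsa.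
    have le_s : (e.+1 <= tagnat.sig2 s + (e - a))%N.
      by rewrite -{1}(subnKC le_ae) -addSn leq_add2r.
    by rewrite -(subnK le_s) exprD N0 mulr0 mulmx0 mxE mulr0.
  have := vs0; suff -> : v 0 s0 = w 0 (cast_ord szq (tagnat.sig1 s0)) by rewrite w0 mxE eqxx.
  rewrite mxE (bigD1 s0) ?eqxx //= [X in _ + X]big1 ?addr0 // => s /andP[/andP[s1 s2]].
  case/negP; rewrite -(tagnat.sig2K s) -(tagnat.sig2K s0) -val_eqE tagnat.eq_Rank s2 andbT.
  by rewrite (inj_eq (@cast_ord_inj _ _ _)) in s1.
by exists B => //; rewrite /Ad BN mulmxK.
Qed.

End RectangularOrbit.

(** * Flags and frames *)

Section Flags.
Variables (k : fieldType) (m n : nat).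
Local Notation V := 'cV[k]_m.
Implicit Types (A : 'M[k]_(m, n)) (v : V).

Definition upper_triangular (p : nat) (b : 'M[k]_p) : Prop :=
  forall i j : 'I_p, (j < i)%N -> b i j = 0.

(** This coordinate description of the members of a flag is what links flags to triangular
    matrices. *)
Lemma mem_span_columns A (i : 'I_n.+2) v : (i <= n)%N ->
  (v \in span_columns A i) <->
  exists2 c : 'cV[k]_n, (forall b : 'I_n, (i <= b)%N -> c b 0 = 0) & v = A *m c.
Proof.
move=> le_in; rewrite ffunE le_in; move: (nat_of_ord i) le_in => {}i.
elim: i v => [|i IH] v le_in.
  rewrite take0 span_nil memv0; split=> [/eqP->|[c c0 ->]].
    by exists 0 => [b _|]; rewrite ?mxE ?mulmx0.
  by rewrite (_ : c = 0) ?mulmx0 //; apply/colP => b; rewrite c0 // mxE.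
have sz : size [seq col j A | j : 'I_n] = n by rewrite size_map size_enum_ord.
pose i' := Ordinal le_in.
rewrite (take_nth 0) ?sz // (nth_map i') ?size_enum_ord // (nth_ord_enum _ i').
rewrite -cats1 span_cat span_seq1; split.
  case/memv_addP => u /(IH _ (ltnW le_in))[c c0 ->] [_ /vlineP[a ->] ->].
  exists (c + a *: delta_mx i' 0) => [b lt_ib|].
    rewrite !mxE c0 1?ltnW // (negbTE (_ : b != i')) ?mulr0 ?addr0 //.
    by rewrite -val_eqE neq_ltn lt_ib orbT.
  by rewrite mulmxDr -scalemxAr colE.
case=> c c0 ->; apply/memv_addP.
exists (A *m (c - c i' 0 *: delta_mx i' 0)).
  apply/(IH _ (ltnW le_in)); exists (c - c i' 0 *: delta_mx i' 0) => // b.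
  rewrite leq_eqVlt => /orP[/eqP ib|/[dup] lt_ib /c0 cb].
    by rewrite (_ : b = i') ?mxE ?eqxx ?mulr1 ?subrr //; apply: val_inj.
  rewrite !mxE cb (negbTE (_ : b != i')) ?mulr0 ?subrr //.
  by rewrite -val_eqE neq_ltn lt_ib orbT.
exists (c i' 0 *: col i' A); first by rewrite memvZ ?memv_line.
by rewrite mulmxBr -scalemxAr colE subrK.
Qed.

(** One-sided inclusions suffice, as both members have dimension [i]; the last member is the whole
    space in either flag. *)
Lemma flag_ext (F G : @flags k m n) :
  (forall i : 'I_n.+2, (i <= n)%N -> (val F i <= val G i)%VS) -> F = G.
Proof.
move=> H; apply: val_inj; apply/ffunP => i.
have [_ F1 _ dF] := set_valP F; have [_ G1 _ dG] := set_valP G.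
have [le_in|lt_ni] := leqP i n.
  by apply/eqP; rewrite eqEdim H //= dF // dG.
have -> : i = ord_max by apply: val_inj => /=; apply/eqP; rewrite eqn_leq lt_ni -ltnS ltn_ord.
by rewrite F1 G1.
Qed.

Lemma flag_of_mul (A A' : @frames k m n) (b : 'M[k]_n) : upper_triangular b ->
  val A' = val A *m b -> flag_of A' = flag_of A.
Proof.
move=> ub E; apply: flag_ext => i le_in; apply/subvP => v /(mem_span_columns _ _ le_in)[c c0 ->].
apply/(mem_span_columns _ _ le_in); exists (b *m c) => [a le_ia|].
  rewrite mxE big1 // => j _; have [le_ij|lt_ji] := leqP i j; first by rewrite c0 ?mulr0.
  by rewrite ub ?mul0r // (leq_trans lt_ji).
by rewrite E mulmxA.
Qed.

(** Together with [flag_of_mul], this identifies the fibers of [flag_of] with the orbits of the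
    invertible upper triangular matrices. Column [j] of [b] holds the coefficients of column [j] of
    [A'] as an element of the member of dimension [j.+1]. *)
Lemma flag_of_eq (A A' : @frames k m n) : flag_of A' = flag_of A ->
  exists b : 'M[k]_n, [/\ upper_triangular b, b \in unitmx & val A' = val A *m b].
Proof.
move=> /(congr1 val) /= FE.
have H (j : 'I_n) : exists c : 'cV[k]_n,
    (forall i : 'I_n, (j < i)%N -> c i 0 = 0) /\ col j (val A') = val A *m c.
  have lt_j : (j.+1 < n.+2)%N by rewrite ltnS ltnW // ltnS ltn_ord.
  have : col j (val A') \in span_columns (val A') (Ordinal lt_j).
    apply/mem_span_columns; first exact: ltn_ord.
    exists (delta_mx j 0) => [i lt_ji|]; last by rewrite -colE.
    by rewrite mxE (negbTE (_ : i != j)) // -val_eqE neq_ltn lt_ji orbT.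
  rewrite FE => /mem_span_columns[|c c0 E]; first exact: ltn_ord.
  by exists c; split=> // i; exact: c0.
have [c Hc] := choice H.
exists (\matrix_(i, j) c j i 0).
have E : val A' = val A *m (\matrix_(i, j) c j i 0).
  apply/matrixP => a j; have [_ /colP/(_ a)] := Hc j; rewrite !mxE => ->.
  by apply: eq_bigr => i _; rewrite mxE.
split=> //; first by move=> i j lt_ji; rewrite mxE; apply: (Hc j).1.
rewrite -row_full_unit /row_full eqn_leq rank_leq_row /=.
by rewrite -[in leqLHS](set_valP A') E mxrankM_maxr.
Qed.

(** Column [j] is a vector of the member of dimension [j.+1] outside the preceding one; comparing
    dimensions, the first [i] columns span the member of dimension [i]. *)
Lemma flag_of_surj (F : @flags k m n) : exists A : @frames k m n, flag_of A = F.
Proof.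
have [F0 F1 Fle dF] := set_valP F.
have H (j : 'I_n) : exists v : V, v \in val F (inord j.+1) /\ v \notin val F (inord j).
  have lt_j : (j.+1 < n.+2)%N by rewrite ltnS ltnW // ltnS ltn_ord.
  have : ~~ (val F (inord j.+1) <= val F (inord j))%VS.
    have j1 : (inord j.+1 : 'I_n.+2) = j.+1 :> nat by rewrite inordK.
    have j0 : (inord j : 'I_n.+2) = j :> nat by rewrite inordK // ltnW.
    by apply/negP => /dimvS; rewrite !dF ?j0 ?j1 ?ltnn // ltnW.
  by case/subvPn => v ? ?; exists v.
have [f Hf] := choice H.
pose A : 'M[k]_(m, n) := \matrix_(a, j) f j a 0.
have colA j : col j A = f j by apply/colP => a; rewrite !mxE.
have sz : size [seq col j A | j : 'I_n] = n by rewrite size_map size_enum_ord.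
have spanE i : (i <= n)%N -> <<take i [seq col j A | j : 'I_n]>>%VS = val F (inord i).
  elim: i => [|i IH] le_in.
    by rewrite take0 span_nil (_ : inord 0 = ord0) ?F0 //; apply: val_inj; rewrite /= inordK.
  pose i' := Ordinal le_in; have [f1 f2] := Hf i'.
  have lt_i : (i.+1 < n.+2)%N by rewrite ltnS ltnW.
  have i1 : (inord i.+1 : 'I_n.+2) = i.+1 :> nat by rewrite inordK.
  have i0 : (inord i : 'I_n.+2) = i :> nat by rewrite inordK // ltnW.
  have d0 : \dim (val F (inord i)) = i by rewrite dF i0 // ltnW.
  have d1 : \dim (val F (inord i.+1)) = i.+1 by rewrite dF i1.
  rewrite (take_nth 0) ?sz // (nth_map i') ?size_enum_ord // (nth_ord_enum _ i') colA.
  rewrite -cats1 span_cat span_seq1 IH 1?ltnW //; apply/eqP; rewrite eqEdim subv_add.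
  rewrite Fle ?i0 ?i1 // -memvE f1 /= d1 -[in leqLHS]d0 ltn_neqAle dimvS ?addvSl // andbT.
  apply: contraNneq f2 => dE.
  rewrite memvE; apply: subv_trans (addvSr (val F (inord i)) _) _.
  by have /eqP <- : val F (inord i) == (val F (inord i) + <[f i']>)%VS
     by rewrite eqEdim addvSl dE /=.
have rA : \rank A = n.
  have szT : size [seq col j A | j : 'I_n] == n by rewrite sz.
  have /(@freeP _ _ _ (Tuple szT)) fA : free [seq col j A | j : 'I_n].
    rewrite /free sz -[in X in <<X>>%VS](take_size [seq col j A | j : 'I_n]) sz.
    by rewrite spanE // dF inordK.
  rewrite -mxrank_tr; apply/eqP; rewrite -/(row_free _) -kermx_eq0.
  apply/rowV0P => c /sub_kermxP c0; apply/rowP => j; rewrite mxE.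
  apply: (fA (fun j => c 0 j)); apply: trmx_inj.
  rewrite trmx0 -c0; apply/rowP => a; rewrite !mxE summxE; apply: eq_bigr => i _.
  have -> : (Tuple szT)`_i = f i by rewrite /= (nth_map i) ?size_enum_ord // nth_ord_enum colA.
  by rewrite !mxE mulrC.
exists (SigSub (mem_set (rA : frames A))); apply: flag_ext => i le_in /=.
by rewrite ffunE le_in spanE // inord_val.
Qed.

Hypothesis le_nm : (n <= m)%N.

Definition first_columns (g : 'M[k]_m) : 'M[k]_(m, n) := colsub (widen_ord le_nm) g.

Lemma first_columns_mul (g p : 'M[k]_m) : first_columns (g *m p) = g *m first_columns p.
Proof. by apply/matrixP => a j; rewrite !mxE; apply: eq_bigr => i _; rewrite mxE. Qed.

Lemma first_columnsE (g : 'M[k]_m) : first_columns g = g *m first_columns 1%:M.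
Proof. by rewrite -first_columns_mul mulmx1. Qed.

Lemma first_columns1_free : (first_columns (1%:M : 'M[k]_m))^T *m first_columns 1%:M = 1%:M.
Proof.
apply/matrixP => i j; rewrite mxE (bigD1 (widen_ord le_nm i)) //= big1 ?addr0.
  by rewrite !mxE eqxx mul1r; congr (_%:R); rewrite -val_eqE /= val_eqE.
by move=> a na; rewrite !mxE (negbTE na) mul0r.
Qed.

Lemma first_columns_frame (g : 'M[k]_m) : g \in unitmx -> frames (first_columns g).
Proof.
move=> gU; rewrite /frames /= first_columnsE eqmxMfull ?row_full_unit //.
apply/eqP; rewrite eqn_leq rank_leq_col /=.
have := mxrankM_maxr (first_columns (1%:M : 'M[k]_m))^T (first_columns 1%:M).
by rewrite first_columns1_free mxrank1.
Qed.

Lemma complete_frame (A : @frames k m n) :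
  exists2 g : 'M[k]_m, g \in unitmx & first_columns g = val A.
Proof.
pose U : 'M[k]_(n, m) := (first_columns 1%:M)^T.
have [||g gU gE] := @complete_rows k n m (val A)^T U.
- by rewrite /row_free mxrank_tr (set_valP A).
- by rewrite /U trmxK first_columns1_free.
exists g^T; first by rewrite unitmx_tr.
by rewrite first_columnsE -[val A]trmxK -gE trmx_mul trmxK.
Qed.

(** In the basis formed by the columns of [g], the flag is the standard one. *)
Lemma mem_flag_unit (g : 'M[k]_m) (A : @frames k m n) (i : 'I_n.+2) v :
  g \in unitmx -> val A = first_columns g -> (i <= n)%N ->
  (v \in val (flag_of A) i) <->
  (forall a : 'I_m, (i <= a)%N -> (invmx g *m v) a 0 = 0).
Proof.
move=> gU AE le_in; rewrite mem_span_columns // AE first_columnsE; split.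
  case=> c c0 -> a le_ia; rewrite -mulmxA mulKmx // mxE big1 // => b _.
  have [/c0->|lt_bi] := leqP i b; first by rewrite mulr0.
  by rewrite !mxE (negbTE (_ : a != widen_ord le_nm b)) ?mul0r // -val_eqE neq_ltn /=
    (leq_trans lt_bi) ?orbT.
move=> H; exists ((first_columns 1%:M)^T *m (invmx g *m v)).
  move=> b le_ib; rewrite mxE big1 // => a _; rewrite !mxE.
  have [->|] := eqVneq; last by rewrite mul0r.
  by have := H (widen_ord le_nm b) le_ib; rewrite mxE => ->; rewrite mulr0.
rewrite -mulmxA; apply: (canRL (mulKVmx gU)); move: (invmx g *m v) H => w H.
apply/colP => a; rewrite [RHS]mxE.
have [lt_an|le_na] := ltnP a n.
  rewrite [RHS](bigD1 (Ordinal lt_an)) //= [X in _ + X]big1 ?addr0.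
    rewrite [first_columns _ _ _]mxE [1%:M _ _]mxE -val_eqE /= eqxx mul1r.
    rewrite [RHS]mxE [RHS](bigD1 a) //= [X in _ + X]big1 ?addr0; last first.
      by move=> c nc; rewrite 3!mxE -val_eqE /= val_eqE (negbTE nc) mul0r.
    by rewrite 3!mxE -val_eqE /= eqxx mul1r.
  move=> b nb; rewrite [first_columns _ _ _]mxE [1%:M _ _]mxE -val_eqE /= eq_sym.
  by rewrite -val_eqE /= in nb; rewrite (negbTE nb) mul0r.
rewrite H ?(leq_trans le_in) // big1 // => b _.
rewrite [first_columns _ _ _]mxE [1%:M _ _]mxE -val_eqE /= (negbTE (_ : a != b :> nat)) ?mul0r //.
by rewrite neq_ltn (leq_trans (ltn_ord b)) ?orbT.
Qed.

End Flags.

(** * Block triangular matrices *)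

Section BlockParts.
Variables (k : fieldType) (r : nat) (alpha : 'I_r -> nat).
Local Notation m := (\sum_i alpha i)%N.
Implicit Types (p q t u z : 'M[k]_m).

Lemma block_diagonalP t : block_diagonal t <->
  (forall a b : 'I_m, tagnat.sig1 a != tagnat.sig1 b -> t a b = 0).
Proof.
split=> [H a b neq_ab | H i j neq_ij].
  have /matrixP/(_ (tagnat.sig2 a) (tagnat.sig2 b)) := H _ _ neq_ab.
  by rewrite !mxE !tagnat.sig2K.
by apply/matrixP => a b; rewrite !mxE H // !tagnat.Rank1K.
Qed.

Lemma nilradicalP u : nilradical u <->
  (forall a b : 'I_m, (tagnat.sig1 b <= tagnat.sig1 a)%N -> u a b = 0).
Proof.
split=> [H a b le_ab | H i j le_ij].
  have /matrixP/(_ (tagnat.sig2 a) (tagnat.sig2 b)) := H _ _ le_ab.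
  by rewrite !mxE !tagnat.sig2K.
by apply/matrixP => a b; rewrite !mxE H // !tagnat.Rank1K.
Qed.

(** The projection onto the Lie algebra of the Levi subgroup; [diagonal_partM] shows that it is
    multiplicative on block upper triangular matrices. *)
Definition diagonal_part z : 'M[k]_m :=
  \matrix_(a, b) (if tagnat.sig1 a == tagnat.sig1 b then z a b else 0).

Lemma diagonal_part_diagonal z : block_diagonal (diagonal_part z).
Proof. by apply/block_diagonalP => a b /negbTE ab; rewrite mxE ab. Qed.

Lemma diagonal_part_rest z : block_upper z -> nilradical (z - diagonal_part z).
Proof.
move=> /block_upperP zU; apply/nilradicalP => a b; rewrite leq_eqVlt !mxE eq_sym.
case: (eqVneq (tagnat.sig1 a) _) => [_ _|nab]; first by rewrite subrr.
by rewrite -val_eqE in nab; rewrite (negbTE nab) /= subr0 => /zU.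
Qed.

Lemma block_diagonal_upper t : block_diagonal t -> block_upper t.
Proof. by move=> H i j lt_ji; apply: H; rewrite -val_eqE neq_ltn lt_ji orbT. Qed.

Lemma plus_nilradicalP t u : block_diagonal t -> nilradical u ->
  block_upper (t + u) /\ diagonal_part (t + u) = t.
Proof.
move=> /block_diagonalP tD /nilradicalP uN; split.
  apply/block_upperP => a b lt_ba; rewrite mxE tD ?uN ?addr0 // 1?ltnW //.
  by rewrite -val_eqE neq_ltn lt_ba orbT.
apply/matrixP => a b; rewrite !mxE; case: eqVneq => [ab|/tD->//].
by rewrite uN ?addr0 // ab.
Qed.

Lemma diagonal_partM p q : block_upper p -> block_upper q ->
  diagonal_part (p *m q) = diagonal_part p *m diagonal_part q.
Proof.
move=> /block_upperP pU /block_upperP qU; apply/matrixP => a b; rewrite !mxE.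
case: eqVneq => [ab|nab]; last first.
  rewrite big1 // => c _; rewrite !mxE.
  by case: eqVneq => [ac|]; rewrite ?mul0r //; rewrite -ac (negbTE nab) mulr0.
apply: eq_bigr => c _; rewrite !mxE -ab eq_sym; case: (ltngtP (tagnat.sig1 c) (tagnat.sig1 a)).
- by move=> lt_ca; rewrite pU // !mul0r if_same mul0r.
- by move=> lt_ac; rewrite qU -?ab // if_same !mulr0.
- by move=> /val_inj->; rewrite eqxx.
Qed.

Lemma block_upperX p e : block_upper p -> block_upper (p ^+ e).
Proof.
move=> pU; elim: e => [|e IH]; first exact: block_upper_scalar.
by rewrite exprS -mulmxE; apply: block_upperM.
Qed.

Lemma diagonal_partX p e : block_upper p -> diagonal_part (p ^+ e) = diagonal_part p ^+ e.
Proof.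
move=> pU; elim: e => [|e IH].
  apply/matrixP => a b; rewrite !expr0 !mxE; case: eqVneq => // nab.
  by case: (eqVneq a b) nab => [->|//]; rewrite eqxx.
by rewrite !exprS -!mulmxE diagonal_partM ?IH //; apply: block_upperX.
Qed.

(** The powers of the diagonal part are the diagonal parts of the powers, so nilpotency passes to
    the Levi component. *)
Lemma nilpotent_plus_nilradical z : block_upper z -> nilpotent z ->
  plus_nilradical (@levi_nilpotent k r alpha) z.
Proof.
move=> zU [e ze]; exists (diagonal_part z), (z - diagonal_part z).
split; [|exact: diagonal_part_rest|by rewrite addrC subrK].
split; first exact: diagonal_part_diagonal.
exists e; rewrite -diagonal_partX // ze.
by apply/matrixP => a b; rewrite !mxE if_same.
Qed.

Lemma block_diagonal_mxdiag t : block_diagonal t -> t = \mxdiag_i submxblock t i i.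
Proof.
move=> tD; rewrite -[LHS]submxblockK; apply/eq_mxblock => i j.
by case: eqVneq => [<-|/tD//]; rewrite conform_mx_id.
Qed.

Lemma mxdiag_diagonal (t_ : forall i, 'M[k]_(alpha i)) : block_diagonal (\mxdiag_i t_ i).
Proof. by move=> i j /negbTE ij; rewrite mxblockK ij. Qed.

Lemma mxdiagM (t_ u_ : forall i, 'M[k]_(alpha i)) :
  \mxdiag_i t_ i *m \mxdiag_i u_ i = \mxdiag_i (t_ i *m u_ i).
Proof.
rewrite [\mxdiag_i u_ i]/mxdiag mul_mxdiag_mxblock; apply/eq_mxblock => i j.
by case: eqVneq => [<-|_]; rewrite ?conform_mx_id ?mulmx0.
Qed.

Lemma mxdiagX (t_ : forall i, 'M[k]_(alpha i)) e :
  (\mxdiag_i t_ i) ^+ e = \mxdiag_i (t_ i ^+ e).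
Proof.
elim: e => [|e IH]; first by rewrite expr0 -[LHS]mxdiagZ; apply/eq_mxdiag.
by rewrite exprS IH -mulmxE mxdiagM; apply/eq_mxdiag => i; rewrite exprS.
Qed.

Lemma mxdiag_unit (l_ : forall i, 'M[k]_(alpha i)) : (forall i, l_ i \in unitmx) ->
  \mxdiag_i l_ i \in unitmx.
Proof.
move=> lU; suff : \mxdiag_i l_ i *m \mxdiag_i invmx (l_ i) = 1%:M by case/mulmx1_unit.
by rewrite mxdiagM -mxdiagZ; apply/eq_mxdiag => i; rewrite mulmxV.
Qed.

Lemma submxblock_diagonal_part p i :
  submxblock (diagonal_part p) i i = submxblock p i i.
Proof. by apply/matrixP => a b; rewrite !mxE !tagnat.Rank1K eqxx. Qed.

Lemma submxblockX p i e : block_upper p ->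
  submxblock (p ^+ e) i i = submxblock p i i ^+ e.
Proof.
move=> pU; rewrite -(submxblock_diagonal_part (p ^+ e)) diagonal_partX //.
rewrite (block_diagonal_mxdiag (diagonal_part_diagonal p)) mxdiagX submxblock_diag.
by rewrite submxblock_diagonal_part.
Qed.

End BlockParts.

(** * Powers of Jordan blocks, and nilpotent matrices of size one *)

Section JordanPowers.
Variable k : fieldType.

Lemma jordan_blockX p e : jordan_block k p ^+ e =
  \matrix_(a, b) (b == (a + e)%N :> nat)%:R.
Proof.
elim: e => [|e IH]; apply/matrixP => a b.
  by rewrite expr0 !mxE addn0 eq_sym.
rewrite exprS IH -mulmxE !mxE addnS.
have [lt_a|ge_a] := ltnP a.+1 p.
  rewrite (bigD1 (Ordinal lt_a)) //= big1 ?addr0 => [|c nc].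
    by rewrite !mxE /= eqxx mul1r addSn.
  by rewrite !mxE -val_eqE /= in nc *; rewrite (negbTE nc) mul0r.
rewrite big1 => [|c _].
  rewrite (negbTE (_ : b != (a + e).+1 :> nat)) // neq_ltn.
  by rewrite (leq_trans (ltn_ord b)) // (leq_trans ge_a) // ltnS leq_addr.
rewrite mxE (negbTE (_ : c != a.+1 :> nat)) ?mul0r // neq_ltn.
by rewrite (leq_trans (ltn_ord c)).
Qed.

Lemma jordan_type_exp (d e : nat) (t : 'M[k]_d) mu : jordan_type t mu ->
  all (fun p => p <= e)%N mu -> t ^+ e = 0.
Proof.
case=> _ [sE [g [gU tE]]] /allP le_mu.
apply: (can_inj (fun w => @AdK k d g w gU)); rewrite -Ad_exp // tE Ad0 {g gU tE t}.
case: _ / sE; rewrite castmx_id mxdiagX -[RHS]mxdiag0; apply/eq_mxdiag => i.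
rewrite jordan_blockX; apply/matrixP => a b; rewrite !mxE.
rewrite (negbTE (_ : b != (a + e)%N :> nat)) // neq_ltn (leq_trans (ltn_ord b)) //.
by rewrite (leq_trans (le_mu _ (mem_nth _ (ltn_ord i)))) // leq_addl.
Qed.

Lemma nilpotent_size1 (d : nat) (t : 'M[k]_d) : d = 1%N -> nilpotent t -> t = 0.
Proof.
move=> dE; subst d; case=> e te; apply/matrixP => i j; rewrite !ord1 [RHS]mxE.
have tE : t = (t 0 0)%:M by exact: mx11_scalar.
have : t ^+ e = (t 0 0 ^+ e)%:M.
  by rewrite {1}tE; elim: e {te} => // e IH; rewrite !exprS IH -mulmxE -scalar_mxM.
rewrite te => /matrixP/(_ 0 0); rewrite !mxE eqxx mulr1n => /esym/eqP.
by rewrite expf_eq0 => /andP[_ /eqP].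
Qed.

End JordanPowers.

(** * Block coordinates for the composition [(1^n, K - n)] *)

Section Composition.
Variables (k : fieldType) (n K : nat).
Local Notation m := (\sum_(i < n.+1) alpha n K i)%N.

(** Blocks before the last have size one, so an index below [n] is its own block number, and every
    other index lies in block [n]. *)
Lemma sig1_alpha (a : 'I_m) : tagnat.sig1 a = minn a n :> nat.
Proof.
have := tagnat.rect a; set i0 := tagnat.sig1 a; have lt_j := ltn_ord (tagnat.sig2 a).
rewrite -/i0 in lt_j; move: (nat_of_ord (tagnat.sig2 a)) lt_j => j lt_j.
have -> : (\sum_(i < n.+1 | (i < i0)%N) alpha n K i = i0)%N.
  rewrite (eq_bigr (fun=> 1%N)) => [|i lt_i]; last first.
    by rewrite /alpha (leq_trans lt_i) // -ltnS ltn_ord.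
  rewrite -(big_ord_widen_cond n.+1 xpredT (fun=> 1%N)) ?sum1_card ?card_ord //.
  exact: ltnW.
move: lt_j; rewrite /alpha; case: (ltnP i0 n) => [lt_i0 |le_ni0 _].
  by rewrite ltnS leqn0 => /eqP-> ->; rewrite addn0; apply/esym/minn_idPl/ltnW.
have -> : nat_of_ord i0 = n by apply/eqP; rewrite eqn_leq le_ni0 -ltnS ltn_ord.
by move=> ->; apply/esym/minn_idPr; rewrite leq_addr.
Qed.

Lemma sig1_alpha_ltn (a b : 'I_m) :
  (tagnat.sig1 b < tagnat.sig1 a)%N = (b < n)%N && (b < a)%N.
Proof.
rewrite !sig1_alpha leq_min !gtn_min ltnn orbF andbC.
case: (ltnP b n) => //= lt_bn; case: (ltnP b a) => //= le_ab.
by rewrite ltnNge (leq_trans le_ab) // ltnW.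
Qed.

Lemma block_upper_alphaP (p : 'M[k]_m) : block_upper p <->
  (forall a b : 'I_m, (b < n)%N -> (b < a)%N -> p a b = 0).
Proof.
rewrite block_upperP; split=> H a b; last by rewrite sig1_alpha_ltn => /andP[]; exact: H.
by move=> lt_bn lt_ba; apply: H; rewrite sig1_alpha_ltn lt_bn.
Qed.

Lemma last_block0P (p : 'M[k]_m) : submxblock p ord_max ord_max = 0 <->
  (forall a b : 'I_m, (n <= a)%N -> (n <= b)%N -> p a b = 0).
Proof.
have E (a : 'I_m) : (n <= a)%N -> tagnat.sig1 a = ord_max.
  by move=> le_na; apply: val_inj; rewrite /= sig1_alpha; apply/minn_idPr.
split=> [H a b /E aE /E bE|H].
  move: (tagnat.sig2 a) (tagnat.sig2K a) (tagnat.sig2 b) (tagnat.sig2K b).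
  by rewrite aE bE => i <- j <-; have /matrixP/(_ i j) := H; rewrite !mxE.
apply/matrixP => i j; rewrite !mxE; apply: H.
  by have := sig1_alpha (tagnat.Rank _ i); rewrite tagnat.Rank1K => /esym/minn_idPr.
by have := sig1_alpha (tagnat.Rank _ j); rewrite tagnat.Rank1K => /esym/minn_idPr.
Qed.

End Composition.

(** * Lines meeting the rectangular orbit *)

Section Lines.
Variable k : numFieldType.

(** In characteristic zero the naturals below [size q] are distinct points, and a nonzero polynomial
    has fewer roots than that. *)
Lemma poly_nonroot (q : {poly k}) : q != 0 -> exists c, q.[c] != 0.
Proof.
move=> q0; pose rs := [seq i%:R : k | i <- iota 0 (size q)].
have urs : uniq rs.
  by rewrite map_inj_uniq ?iota_uniq // => i j /eqP; rewrite eqr_nat => /eqP.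
have /allPn [c _ qc] : ~~ all (root q) rs.
  apply/negP => /(max_poly_roots q0)/(_ urs).
  by rewrite size_map size_iota ltnn.
by exists c.
Qed.

Lemma peval_line (V : vectType k) p (u v : V) :
  exists q : {poly k}, forall c, peval p ((1 - c) *: u + c *: v) = q.[c].
Proof.
elim/mpolyind: p => [|a mm p _ _ [q qE]].
  by exists 0 => c; rewrite /peval meval0 horner0.
exists (a%:P * \prod_i ((1 - 'X) * (coord (vbasis {:V}) i u)%:P +
  'X * (coord (vbasis {:V}) i v)%:P) ^+ (mm i) + q) => c.
rewrite hornerD -qE hornerM hornerC horner_prod /peval mevalD mevalZ mevalX.
congr (_ * _ + _); apply: eq_bigr => i _.
by rewrite horner_exp !hornerE linearD !linearZ.
Qed.

(** Irreducibility of the line: polynomials witnessing [U] at [u] and [W] at [v] restrict to nonzero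
    polynomials in [c], as seen at [c = 0] and [c = 1], and their product has a nonroot. *)
Lemma opens_meet_line (V : vectType k) (U W : set V) (u v : V) :
  affine_open U -> affine_open W -> U u -> W v ->
  exists c, U ((1 - c) *: u + c *: v) /\ W ((1 - c) *: u + c *: v).
Proof.
move=> /affine_openP oU /affine_openP oW /oU[p pu Hp] /oW[p' pv Hp'].
have [q qE] := peval_line p u v; have [q' qE'] := peval_line p' u v.
have [|c] := @poly_nonroot (q * q').
  rewrite mulf_neq0 //; apply/eqP => q0.
    by move: pu; have := qE 0; rewrite q0 horner0 subr0 scale1r scale0r addr0 => ->; rewrite eqxx.
  by move: pv; have := qE' 1; rewrite q0 horner0 subrr scale1r scale0r add0r => ->; rewrite eqxx.
rewrite hornerM mulf_eq0 negb_or -qE -qE' => /andP[pc pc'].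
by exists c; split; [exact: Hp|exact: Hp'].
Qed.

(** This puts [z] in the closure of the orbit of [t]. For positive exponent, [nilpotent_direction]
    supplies [D], [Y], [X]; the [e]-th power vanishes along the whole line, and [W] is the
    nonvanishing locus of the determinant that [nilpotent_jordan_form] requires. *)
Lemma rectangular_orbit_dense_line (e q d : nat) (t z : 'M[k]_d) :
  d = (e * q)%N -> jordan_type t (nseq q e) -> z ^+ e = 0 ->
  exists (D : 'M[k]_d) (W : set 'M[k]_d), [/\ affine_open W, W D &
    forall c, W ((1 - c) *: z + c *: D) ->
      exists2 h, h \in unitmx & (1 - c) *: z + c *: D = Ad h t].
Proof.
have oT (V : vectType k) : affine_open [set: V] by exact: affine_openT.
(* For [e = 0] the dimension is zero and all matrices coincide. *)
case: e => [|e] dE tJ z0.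
  subst d; exists 0, setT; split=> // c _; exists 1%:M; rewrite ?unitmx1 //.
  by rewrite [LHS]flatmx0 [RHS]flatmx0.
have [D [Y [X [HD YX]]]] := nilpotent_direction dE z0.
exists D, [set N | setT N /\ \det (Y *m N ^+ e *m X) != 0]; split.
- apply: affine_open_neq0; first exact: oT.
  apply: regular_det; first exact: oT.
  apply: regular_mxM; [exact: oT| |exact/regular_mx_const/oT].
  apply: regular_mxM; [exact: oT|exact/regular_mx_const/oT|].
  apply: (@regular_mxX _ _ _ _ id); first exact: oT.
  move=> i j; apply: affine_regular_linear; first exact: oT.
  by move=> a u v; rewrite !mxE.
- by split=> //; rewrite YX det1 oner_neq0.
- move=> c [_ detc]; apply: (nilpotent_jordan_form (Y := Y) (X := X)) tJ _ _.
    exact: HD.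
  by rewrite unitmxE unitfE.
Qed.

End Lines.

(** * The flag attached to a point of the twisted product *)

Section TwistedFlags.
Variables (k : fieldType) (n K : nat).
Hypothesis le_nK : (n <= K)%N.
Local Notation m := (\sum_(i < n.+1) alpha n K i)%N.
Local Notation prs := (@pairs k n.+1 (alpha n K)).
Local Notation tw := (twisted k (alpha n K)).

Lemma le_n_sum_alpha : (n <= m)%N. Proof. by rewrite sum_alpha. Qed.
Local Notation le_nm := le_n_sum_alpha.

Lemma pair_unit (a : prs) : (val a).1 \in unitmx.
Proof. by have [] := set_valP a. Qed.

Lemma pair_upper (a : prs) : block_upper (val a).2.
Proof.
have [_ [t [u [[tD _] uN ->]]]] := set_valP a.
by have [] := plus_nilradicalP tD uN.
Qed.

Definition pair_frame (a : prs) : @frames k m n :=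
  SigSub (mem_set (first_columns_frame le_nm (pair_unit a))).

Lemma pair_frameE (a : prs) : val (pair_frame a) = first_columns le_nm (val a).1.
Proof. by []. Qed.

Lemma mem_pair_flag (a : prs) (i : 'I_n.+2) v : (i <= n)%N ->
  (v \in val (flag_of (pair_frame a)) i) <->
  (forall j : 'I_m, (i <= j)%N -> (invmx (val a).1 *m v) j 0 = 0).
Proof. exact: (mem_flag_unit _ (pair_unit a) (pair_frameE a)). Qed.

Lemma block_upper_coords (p : 'M[k]_m) (w : 'cV[k]_m) (i : nat) : block_upper p ->
  (i <= n)%N -> (forall j : 'I_m, (i <= j)%N -> w j 0 = 0) ->
  forall j : 'I_m, (i <= j)%N -> (p *m w) j 0 = 0.
Proof.
move=> /block_upper_alphaP pU le_in w0 j le_ij; rewrite mxE big1 // => l _.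
have [/w0->|lt_li] := leqP i l; first by rewrite mulr0.
by rewrite pU ?mul0r // (leq_trans lt_li).
Qed.

Lemma same_orbit_flag (a b : prs) : same_orbit a b ->
  flag_of (pair_frame a) = flag_of (pair_frame b).
Proof.
move=> /asboolP [p [pU pB] E]; apply: flag_ext => i le_in; apply/subvP => v.
move/(mem_pair_flag _ _ le_in) => H; apply/(mem_pair_flag _ _ le_in).
rewrite E /= invmxM ?pair_unit ?unitmx_inv // invmxK -mulmxA.
exact: block_upper_coords.
Qed.

(** With equal flags, the transition matrix between the two bases stabilizes the standard flag,
    hence lies in [P]. The second components are then conjugate by it, both being determined by the
    common image under [xi]. *)
Lemma same_flag_orbit (a b : prs) : flag_of (pair_frame a) = flag_of (pair_frame b) ->
  Ad (val a).1 (val a).2 = Ad (val b).1 (val b).2 -> same_orbit a b.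
Proof.
move=> FE xE; have aU := pair_unit a; have bU := pair_unit b.
apply/asboolP; exists (invmx (val b).1 *m (val a).1).
  split; first by rewrite /= unitmx_mul unitmx_inv bU.
  apply/block_upper_alphaP => i j lt_jn lt_ji.
  have lt_j : (j.+1 < n.+2)%N by rewrite ltnS ltnW.
  have : col j (val a).1 \in val (flag_of (pair_frame a)) (Ordinal lt_j).
    apply/mem_pair_flag => // l lt_jl; rewrite colE mulKmx // mxE.
    by rewrite (negbTE (_ : l != j)) // -val_eqE neq_ltn lt_jl orbT.
  rewrite FE => /mem_pair_flag => /(_ lt_jn i lt_ji).
  by rewrite colE mulmxA -colE mxE.
case: (val b) bU xE => [g' z'] /= g'U xE.
rewrite invmxM ?unitmx_inv // invmxK mulmxA mulmxV // mul1mx.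
by rewrite AdM ?unitmx_inv // xE AdK.
Qed.

Definition twisted_flag (c : tw) : @flags k m n := flag_of (pair_frame (repr c)).

Lemma twisted_flag_pi (a : prs) : twisted_flag (\pi_tw a) = flag_of (pair_frame a).
Proof.
apply: same_orbit_flag.
by have /eqmodP : repr (\pi_tw a) = a %[mod tw] by rewrite reprK.
Qed.

Lemma pi_twisted_eq (a b : prs) : flag_of (pair_frame a) = flag_of (pair_frame b) ->
  Ad (val a).1 (val a).2 = Ad (val b).1 (val b).2 -> \pi_tw a = \pi_tw b.
Proof. by move=> FE xE; apply/eqmodP; apply: same_flag_orbit. Qed.

(** In the basis [g] the flag is standard; testing stability on the first [n] basis vectors gives
    the zero entries, while the full last member imposes nothing. *)
Lemma stable_flagP (g x : 'M[k]_m) (A : @frames k m n) : g \in unitmx ->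
  val A = first_columns le_nm g ->
  (forall i, (mulv x @: val (flag_of A) i <= val (flag_of A) i)%VS) <->
  block_upper (Ad (invmx g) x).
Proof.
move=> gU AE; split=> [H|zU i].
  apply/block_upper_alphaP => a b lt_bn lt_ba.
  have lt_b : (b.+1 < n.+2)%N by rewrite ltnS ltnW.
  have gb : col b g \in val (flag_of A) (Ordinal lt_b).
    apply/(mem_flag_unit _ gU AE) => // l lt_bl; rewrite colE mulKmx // mxE.
    by rewrite (negbTE (_ : l != b)) // -val_eqE neq_ltn lt_bl orbT.
  have := subvP (H (Ordinal lt_b)) _ (memv_img (mulv x) gb).
  rewrite lfunE /= => /(mem_flag_unit (i := Ordinal lt_b) _ gU AE lt_bn)/(_ a lt_ba).
  by rewrite colE /Ad invmxK !mulmxA -colE mxE.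
have [F0 F1 _ _] := set_valP (flag_of A).
have [le_in|lt_ni] := leqP i n; last first.
  have -> : i = ord_max by apply: val_inj => /=; apply/eqP; rewrite eqn_leq lt_ni -ltnS ltn_ord.
  by rewrite F1 subvf.
apply/subvP => _ /memv_imgP[v /(mem_flag_unit _ gU AE le_in) vF ->].
apply/(mem_flag_unit _ gU AE le_in); rewrite lfunE /=.
have -> : invmx g *m (x *m v) = Ad (invmx g) x *m (invmx g *m v).
  by rewrite /Ad invmxK !mulmxA mulmxK.
exact: block_upper_coords.
Qed.

(** In the basis [g], inclusion in the member of dimension [n] means that the rows of index at least
    [n] of the [e]-th power vanish. Block triangularity already clears their first [n] columns,
    leaving the last diagonal block. *)
Lemma image_in_flagP (g x : 'M[k]_m) (A : @frames k m n) e : g \in unitmx ->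
  val A = first_columns le_nm g -> block_upper (Ad (invmx g) x) ->
  (limg (mulv (x ^+ e)) <= val (flag_of A) (inord n))%VS <->
  submxblock (Ad (invmx g) x ^+ e) ord_max ord_max = 0.
Proof.
move=> gU AE zU; have iU : invmx g \in unitmx by rewrite unitmx_inv.
have nE : (inord n : 'I_n.+2) = n :> nat by rewrite inordK.
have nF := mem_flag_unit _ gU AE (eq_leq nE).
have /block_upper_alphaP zeU := block_upperX e zU.
split=> [H|/last_block0P H].
  apply/last_block0P => a b le_na le_nb.
  have := subvP H _ (memv_img (mulv (x ^+ e)) (memvf (col b g))).
  move=> /nF; rewrite nE => /(_ a le_na).
  by rewrite lfunE /= colE Ad_exp // /Ad invmxK !mulmxA -colE mxE.
apply/subvP => _ /memv_imgP[v _ ->]; apply/nF => a; rewrite nE => le_na.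
have -> : invmx g *m (mulv (x ^+ e) v) = Ad (invmx g) x ^+ e *m (invmx g *m v).
  by rewrite lfunE /= Ad_exp // /Ad invmxK !mulmxA mulmxK.
rewrite mxE big1 // => b _; have [le_nb|lt_bn] := leqP n b; first by rewrite H ?mul0r.
by rewrite zeU ?mul0r // (leq_trans lt_bn).
Qed.

Lemma pair_image_flagP (a : prs) e :
  (limg (mulv (Ad (val a).1 (val a).2 ^+ e)) <= val (flag_of (pair_frame a)) (inord n))%VS <->
  submxblock ((val a).2 ^+ e) ord_max ord_max = 0.
Proof.
have aU := pair_unit a; have := pair_upper a; rewrite -{1 3}(AdK (val a).2 aU) => zU.
exact: image_in_flagP.
Qed.

Lemma open_pairs_last_block (e : nat) :
  affine_open [set gz : 'M[k]_m * 'M[k]_m | submxblock (gz.2 ^+ e) ord_max ord_max != 0].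
Proof.
have oT := @affine_openT k ('M[k]_m * 'M[k]_m)%type.
apply/affine_openP => gz /matrix0Pn [i [j ij]].
pose f (gz : 'M[k]_m * 'M[k]_m) := (gz.2 ^+ e) (tagnat.Rank _ i) (tagnat.Rank _ j).
have fE gz' : submxblock (gz'.2 ^+ e) ord_max ord_max i j = f gz' by rewrite mxE.
have rf : affine_regular setT f.
  apply: (@regular_mxX _ _ _ _ (fun gz : 'M[k]_m * 'M[k]_m => gz.2)); first exact: oT.
  move=> a b; apply: affine_regular_linear; first exact: oT.
  by move=> c u v; rewrite !mxE.
have /affine_openP/(_ gz)[] := affine_open_neq0 oT rf; first by split; rewrite // -fE.
move=> p pv Hp; exists p => // w /Hp[_ fw]; apply/matrix0Pn.
by exists i, j; rewrite fE.
Qed.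

End TwistedFlags.

(** * The closure of the orbit [O_y] *)

Section OrbitClosure.
Variables (k : numFieldType) (n K e q : nat).
Hypothesis le_nK : (n <= K)%N.
Local Notation m := (\sum_(i < n.+1) alpha n K i)%N.
Local Notation prs := (@pairs k n.+1 (alpha n K)).
Local Notation tw := (twisted k (alpha n K)).
Variable t_ : forall i : 'I_n.+1, 'M[k]_(alpha n K i).
Hypothesis t_nilpotent : nilpotent (\mxdiag_i t_ i).
Hypothesis last_size : alpha n K ord_max = (e * q)%N.
Hypothesis last_type : jordan_type (t_ ord_max) (nseq q e).

Lemma block_nilpotent (z : 'M[k]_m) (i : 'I_n.+1) : block_diagonal z -> nilpotent z ->
  nilpotent (submxblock z i i).
Proof.
move=> zD [f zf]; exists f.
by rewrite -submxblockX ?zf ?submxblock0 //; exact: block_diagonal_upper.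
Qed.

Lemma small_block0 (z : 'M[k]_m) (i : 'I_n.+1) : i != ord_max ->
  block_diagonal z -> nilpotent z -> submxblock z i i = 0.
Proof.
move=> ni zD zN; apply: nilpotent_size1; last exact: block_nilpotent.
rewrite /alpha ifT // ltn_neqAle -ltnS ltn_ord andbT.
by apply: contraNneq ni => ni; apply/eqP/val_inj.
Qed.

(** Block sizes depend on [i], so [conform_mx] transports [N] to the block where [i] equals
    [ord_max]. *)
Definition last_block_mx (N : 'M[k]_(alpha n K ord_max)) : 'M[k]_m :=
  \mxdiag_i (if i == ord_max then conform_mx 0 N else 0).

Lemma last_block_mxE (z : 'M[k]_m) : block_diagonal z -> nilpotent z ->
  z = last_block_mx (submxblock z ord_max ord_max).
Proof.
move=> zD zN; rewrite [LHS]block_diagonal_mxdiag //; apply/eq_mxdiag => i.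
case: eqVneq => [->|ni]; first by rewrite conform_mx_id.
exact: small_block0.
Qed.

Lemma last_block_mx_linear a b (N N' : 'M[k]_(alpha n K ord_max)) :
  last_block_mx (a *: N + b *: N') = a *: last_block_mx N + b *: last_block_mx N'.
Proof.
rewrite -!mul_scalar_mx /last_block_mx -!mxdiagZ !mxdiagM -mxdiagD; apply/eq_mxdiag => i.
case: eqVneq => [->|_]; last by rewrite !mulmx0 addr0.
by rewrite !conform_mx_id !mul_scalar_mx.
Qed.

Lemma last_block_mxK N : submxblock (last_block_mx N) ord_max ord_max = N.
Proof. by rewrite submxblock_diag eqxx conform_mx_id. Qed.

Lemma block_diagonal_Ad (l z : 'M[k]_m) : l \in unitmx -> block_diagonal l ->
  block_diagonal z -> block_diagonal (Ad l z).
Proof.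
move=> lU lD zD.
have D_M (p p' : 'M[k]_m) : block_diagonal p -> block_diagonal p' -> block_diagonal (p *m p').
  move=> /block_diagonal_mxdiag-> /block_diagonal_mxdiag->; rewrite mxdiagM.
  exact: mxdiag_diagonal.
apply: (D_M); first exact: (D_M).
apply: (invmx_closed _ _ D_M) => [c|p p' pD p'D|//|//].
  by rewrite -mxdiagZ; exact: mxdiag_diagonal.
by move=> i j ij; rewrite submxblockD pD ?p'D ?addr0.
Qed.

(** The Levi element is [h] on the last block and the identity elsewhere; the other blocks of [t]
    are nilpotent of size one, hence zero. *)
Lemma last_block_mx_orbit (h : 'M[k]_(alpha n K ord_max)) : h \in unitmx ->
  levi_orbit (\mxdiag_i t_ i) (last_block_mx (Ad h (t_ ord_max))).
Proof.
move=> hU; pose l_ i : 'M[k]_(alpha n K i) := if i == ord_max then conform_mx 1%:M h else 1%:M.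
have lU : \mxdiag_i l_ i \in unitmx.
  apply: mxdiag_unit => i; rewrite /l_; case: eqVneq => [->|_]; last exact: unitmx1.
  by rewrite conform_mx_id.
exists (\mxdiag_i l_ i); first by split=> //; exact: mxdiag_diagonal.
apply: (can_inj (mulmxK lU)); rewrite /Ad mulmxKV // !mxdiagM; apply/eq_mxdiag => i.
rewrite /l_; case: eqVneq => [->|ni]; first by rewrite !conform_mx_id mulmxKV.
have -> : t_ i = 0.
  by have := small_block0 ni (mxdiag_diagonal t_) t_nilpotent; rewrite submxblock_diag.
by rewrite mulmx0 mul0mx.
Qed.

Lemma orbit_last_block (z : 'M[k]_m) : plus_nilradical (levi_orbit (\mxdiag_i t_ i)) z ->
  submxblock (z ^+ e) ord_max ord_max = 0.
Proof.
case=> _ [u [[l [lU lD] <-] uN ->]].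
have tD := mxdiag_diagonal t_.
have [zU zE] := plus_nilradicalP (block_diagonal_Ad lU lD tD) uN.
rewrite submxblockX // -submxblock_diagonal_part zE -submxblockX; last first.
  exact/block_diagonal_upper/block_diagonal_Ad.
rewrite Ad_exp // mxdiagX.
(* For [e = 0] the power is the identity, but the last block is then empty. *)
have [e0|e_gt0] := posnP e.
  apply/matrixP => i; have : (i < e * q)%N by rewrite -last_size ltn_ord.
  by rewrite e0.
suff -> : \mxdiag_i (t_ i ^+ e) = 0 by rewrite Ad0 submxblock0.
rewrite -[RHS]mxdiag0; apply/eq_mxdiag => i.
have [->|ni] := eqVneq i ord_max.
  by apply: jordan_type_exp last_type _; apply/allP => p /nseqP[->].
have -> : t_ i = 0.
  by have := small_block0 ni tD t_nilpotent; rewrite submxblock_diag.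
by rewrite expr0n gtn_eqF.
Qed.

(** The vanishing is a closed condition that holds on the orbit. Conversely, moving the last Levi
    block along a line towards a model [D] produces orbit points in every neighborhood. *)
Lemma closure_orbitP (a : prs) :
  zclosure (X := twisted_space k (alpha n K)) (twisted_orbit (\mxdiag_i t_ i)) (\pi_tw a) <->
  submxblock ((val a).2 ^+ e) ord_max ord_max = 0.
Proof.
split=> [H|ze U [V oV VE] Ua].
  apply: contrapT => /eqP za.
  (* Stated through [xi] and the flag, the condition is independent of the representative, so it
     defines a subset of the quotient. *)
  pose U : set tw := [set c |
    ~ (limg (mulv (xi c ^+ e)) <= val (twisted_flag le_nK c) (inord n))%VS].
  have UE (b : prs) : U (\pi_tw b) <-> submxblock ((val b).2 ^+ e) ord_max ord_max != 0.
    rewrite -[U _]/(~ (limg (mulv (xi (\pi_tw b) ^+ e)) <=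
       val (twisted_flag le_nK (\pi_tw b)) (inord n))%VS) xi_pi twisted_flag_pi.
    have := pair_image_flagP le_nK b e; set P := (_ <= _)%VS => bP.
    by split=> [nP|/eqP nz /bP//]; apply/eqP => /bP.
  have [|c [[b bO <-] /UE]] := H U _ ((UE a).2 za).
    exists [set gz | submxblock (gz.2 ^+ e) ord_max ord_max != 0].
      exact: open_pairs_last_block.
    by apply/seteqP; split=> b /UE.
  by rewrite orbit_last_block ?eqxx.
have [aU [t' [u [[t'D t'N] uN zE]]]] := set_valP a.
set g := (val a).1 in aU; set z := (val a).2 in zE ze.
pose N := submxblock t' ord_max ord_max.
have Ne : N ^+ e = 0.
  have [zU dz] := plus_nilradicalP t'D uN; rewrite -zE in zU dz.
  by rewrite /N -dz submxblock_diagonal_part -submxblockX.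
have [D [W [oW WD HW]]] := rectangular_orbit_dense_line last_size last_type Ne.
pose F (gz : 'M[k]_m * 'M[k]_m) := submxblock gz.2 ord_max ord_max : 'M[k]_(alpha n K ord_max).
have F_mor : morphism_on (X := affine ('M[k]_m * 'M[k]_m)%type) (Y := affine _) setT F.
  apply: regular_morphism_on => [|f fS]; first exact: affine_openT.
  apply: affine_regular_linear => [|c v w]; first exact: affine_openT.
  rewrite /= -fS; congr f.
  by apply/matrixP => i j; rewrite !mxE.
have [oFW _] := F_mor W oW.
pose gz N' := (g, last_block_mx N' + u).
have FE N' : F (gz N') = N'.
  by rewrite /F /gz /= submxblockD last_block_mxK uN // addr0.
have Va : V (gz N).
  have : (\pi_tw @^-1` U) a by [].
  rewrite VE /= [val a]surjective_pairing -/g -/z zE {1}(last_block_mxE t'D t'N).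
  by [].
(* The line runs in the ambient affine space, where [V] is open; membership in [pairs] is checked
   only for the point finally selected. *)
have [|c []] := opens_meet_line oV oFW Va (_ : _ (gz D)).
  by split; rewrite // /= FE.
have -> : (1 - c) *: gz N + c *: gz D = gz ((1 - c) *: N + c *: D).
  have convex (p : nat) (w : 'M[k]_p) : (1 - c) *: w + c *: w = w.
    by rewrite -scalerDl subrK scale1r.
  rewrite /gz last_block_mx_linear; set w1 := last_block_mx _; set w2 := last_block_mx _.
  have -> : (1 - c) *: w1 + c *: w2 + u = (1 - c) *: (w1 + u) + c *: (w2 + u).
    by rewrite -[u in LHS](convex _ u) !scalerDr addrACA.
  by rewrite -[g in RHS](convex _ g).
move=> Vc [_]; rewrite /= FE => /HW [h hU hE]; rewrite hE in Vc.
have oc := last_block_mx_orbit hU.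
have gzP : prs (gz (Ad h (t_ ord_max))).
  split=> //; exists (last_block_mx (Ad h (t_ ord_max))), u; split=> //.
  have [l [lU lD] <-] := oc; split; first exact/block_diagonal_Ad/mxdiag_diagonal.
  by have [f tf] := t_nilpotent; exists f; rewrite Ad_exp // tf Ad0.
pose b : prs := SigSub (mem_set gzP).
exists (\pi_tw b); split.
  by exists b => //; exists (last_block_mx (Ad h (t_ ord_max))), u.
have : (val @^-1` V) b by [].
by rewrite -VE.
Qed.

End OrbitClosure.

(** * Local sections of the flag variety *)

Section ColumnReduction.
Variables (k : fieldType) (m n : nat).
Hypothesis le_nm : (n <= m)%N.
Implicit Types (B b : 'M[k]_n) (A : 'M[k]_(m, n)).

(** The leading principal block of size [j.+1], padded by the identity so that every truncation has
    the same size and its determinant is the leading minor. *)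
Definition truncate (j : 'I_n) B : 'M[k]_n :=
  \matrix_(a, c) (if (a <= j)%N && (c <= j)%N then B a c else (a == c)%:R).

Lemma upper_triangularV b : b \in unitmx -> upper_triangular b ->
  upper_triangular (invmx b).
Proof.
apply: invmx_closed => [c|p q pU qU|p q pU qU] i j lt_ji.
- by rewrite mxE -val_eqE gtn_eqF.
- by rewrite mxE pU ?qU ?addr0.
rewrite mxE big1 // => l _; have [lt_li|le_il] := ltnP l i; first by rewrite pU ?mul0r.
by rewrite qU ?mulr0 // (leq_trans lt_ji).
Qed.

Lemma truncate1 j : truncate j 1%:M = 1%:M.
Proof. by apply/matrixP => a c; rewrite !mxE; case: ifP. Qed.

(** Triangularity confines the columns of [b] of index at most [j] to the leading block. *)
Lemma truncateM j B b : upper_triangular b ->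
  truncate j (B *m b) = truncate j B *m truncate j b.
Proof.
move=> bU; apply/matrixP => a c; rewrite [LHS]mxE [RHS]mxE.
have [le_aj|lt_ja] /= := leqP a j; last first.
  rewrite (bigD1 a) //= [X in _ + X]big1 ?addr0 => [|l nl].
    by rewrite !mxE leqNgt lt_ja /= eqxx mul1r.
  by rewrite mxE leqNgt lt_ja /= eq_sym (negbTE nl) mul0r.
have [le_cj|lt_jc] := leqP c j; last first.
  rewrite (bigD1 c) //= [X in _ + X]big1 ?addr0 => [|l nl].
    by rewrite !mxE (leqNgt c) lt_jc !andbF eqxx mulr1.
  by rewrite [truncate j b _ _]mxE (leqNgt c) lt_jc andbF (negbTE nl) mulr0.
rewrite mxE; apply: eq_bigr => l _; rewrite !mxE le_aj le_cj andbT /=.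
have [//|lt_jl] := leqP l j.
have lt_cl : (c < l)%N by rewrite (leq_ltn_trans le_cj).
by rewrite bU // -!val_eqE /= [in X in _ = _ * X]gtn_eqF // !mulr0.
Qed.

Lemma truncate_unit j b : upper_triangular b -> b \in unitmx -> truncate j b \in unitmx.
Proof.
move=> bU bI; suff : truncate j b *m truncate j (invmx b) = 1%:M by case/mulmx1_unit.
by rewrite -truncateM ?mulmxV ?truncate1 //; exact: upper_triangularV.
Qed.

Lemma truncate_low (j : 'I_n) B (w : 'cV[k]_n) (a : 'I_n) : (j < a)%N ->
  (truncate j B *m w) a 0 = w a 0.
Proof.
move=> lt_ja; rewrite mxE (bigD1 a) //= [X in _ + X]big1 ?addr0 => [|l nl].
  by rewrite mxE leqNgt lt_ja /= eqxx mul1r.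
by rewrite mxE leqNgt lt_ja /= eq_sym (negbTE nl) mul0r.
Qed.

Lemma truncate_high (j : 'I_n) B (w : 'cV[k]_n) (a : 'I_n) : (a <= j)%N ->
  (forall c : 'I_n, (j < c)%N -> w c 0 = 0) ->
  (truncate j B *m w) a 0 = (B *m w) a 0.
Proof.
move=> le_aj w0; rewrite !mxE; apply: eq_bigr => l _; rewrite mxE le_aj /=.
by have [//|/w0->] := leqP l j; rewrite !mulr0.
Qed.

Definition first_rows A : 'M[k]_n := rowsub (widen_ord le_nm) A.

Lemma first_rows_mul A b : first_rows (A *m b) = first_rows A *m b.
Proof. by apply/matrixP => i j; rewrite !mxE; apply: eq_bigr => l _; rewrite mxE. Qed.

(** All leading principal minors of the top square block are nonzero, the classical condition for an
    LU decomposition. *)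
Definition reducible_frame A : Prop := forall j, truncate j (first_rows A) \in unitmx.

(* Right multiplication by [reduction A] is the column operation that turns
   [A] into its lower unitriangular representative, as in the LU decomposition. *)
Definition reduction A : 'M[k]_n :=
  \matrix_(a, j) (invmx (truncate j (first_rows A)) *m delta_mx j 0 : 'cV[k]_n) a 0.

Lemma reduction_col A j :
  col j (reduction A) = invmx (truncate j (first_rows A)) *m delta_mx j 0.
Proof. by apply/colP => a; rewrite !mxE. Qed.

Lemma reduction_upper A : reducible_frame A -> upper_triangular (reduction A).
Proof.
move=> AR a j lt_ja; rewrite mxE -(@truncate_low j (first_rows A)) // mulKVmx //.
by rewrite mxE -val_eqE gtn_eqF.
Qed.

Lemma reduced_top A (a j : 'I_n) : reducible_frame A -> (a <= j)%N ->
  (A *m reduction A) (widen_ord le_nm a) j = (a == j)%:R.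
Proof.
move=> AR le_aj; have -> : (A *m reduction A) (widen_ord le_nm a) j =
    (first_rows A *m col j (reduction A)) a 0.
  by rewrite !mxE; apply: eq_bigr => l _; rewrite !mxE.
rewrite -(@truncate_high j _ _ _ le_aj) => [|c lt_jc].
  by rewrite reduction_col mulKVmx // mxE andbT.
by rewrite mxE reduction_upper.
Qed.

Lemma reducible_frame_mul A b : upper_triangular b -> b \in unitmx ->
  reducible_frame A -> reducible_frame (A *m b).
Proof.
move=> bU bI AR j; rewrite first_rows_mul truncateM // unitmx_mul AR.
exact: truncate_unit.
Qed.

(** The reduced frame depends only on the flag. Column [j] of either reduction is supported on
    indices up to [j] and solves an invertible truncated system; multiplying the new solution by [b]
    gives the old one. *)
Lemma reduced_mul A b : upper_triangular b -> b \in unitmx -> reducible_frame A ->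
  (A *m b) *m reduction (A *m b) = A *m reduction A.
Proof.
move=> bU bI AR; rewrite -mulmxA; congr (_ *m _); apply/matrixP => a j.
set y := col j (reduction A); set w := col j (reduction (A *m b)).
have -> : reduction A a j = y a 0 by rewrite [RHS]mxE.
have -> : (b *m reduction (A *m b)) a j = (b *m w) a 0.
  by rewrite [LHS]mxE [RHS]mxE; apply: eq_bigr => l _; rewrite [w _ _]mxE.
have bR := reducible_frame_mul bU bI AR.
have w0 (c : 'I_n) : (j < c)%N -> w c 0 = 0 by move=> lt_jc; rewrite [w _ _]mxE reduction_upper.
have yw : y = truncate j b *m w.
  have tbU := truncate_unit j bU bI.
  by rewrite /y /w !reduction_col first_rows_mul truncateM // invmxM // -mulmxA mulKVmx.
have [le_aj|lt_ja] := leqP a j.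
  by rewrite yw truncate_high.
rewrite [RHS]mxE reduction_upper // [LHS]mxE big1 // => l _.
have [le_lj|/w0->] := leqP l j; last by rewrite mulr0.
by rewrite bU ?mul0r // (leq_ltn_trans le_lj).
Qed.

(** The test [insub] succeeds for columns below [n]; the others are standard basis vectors.
    Completing a reduced frame thus gives a lower unitriangular, hence invertible, matrix. *)
Definition square_completion A : 'M[k]_m :=
  \matrix_(a, c) (if insub (val c) is Some j then A a j else (a == c)%:R).

Lemma first_columns_square A : first_columns le_nm (square_completion A) = A.
Proof.
apply/matrixP => a j; rewrite !mxE insubT /=; first by rewrite (leq_trans (ltn_ord j)).
by move=> p; congr (A a _); apply: val_inj.
Qed.

Lemma square_completion_unit A : reducible_frame A ->
  square_completion (A *m reduction A) \in unitmx.
Proof.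
move=> AR; set N := A *m _.
have NE (a c : 'I_m) : (a <= c)%N -> square_completion N a c = (a == c)%:R.
  move=> le_ac; rewrite mxE; case: insubP => [j /= lt_cn jE|//].
  have lt_an : (a < n)%N by rewrite (leq_ltn_trans le_ac).
  have -> : a = widen_ord le_nm (Ordinal lt_an) by apply: val_inj.
  rewrite reduced_top //= ?jE // -!val_eqE /= jE //.
rewrite unitmxE det_trig.
  by rewrite big1 ?unitr1 // => a _; rewrite NE ?eqxx.
by apply/is_trig_mxP => a c lt_ac; rewrite NE 1?ltnW // -val_eqE ltn_eqF.
Qed.

End ColumnReduction.

(** * Morphisms into spaces of matrices and pairs of matrices *)

Section RegularMatrixMaps.
Variables (k : fieldType) (V : vectType k) (O : set V).
Hypothesis oO : affine_open O.

Lemma regular_scalar_mx (p q : nat) (f : 'M[k]_(p, q) -> k) (F : V -> 'M[k]_(p, q)) :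
  scalar f -> regular_mx O F -> affine_regular O (f \o F).
Proof.
move=> /scalar_morph [fD f0 fZ] rF.
apply: (@affine_regular_ext _ _ _ (fun v => \sum_i \sum_j F v i j * f (delta_mx i j))).
  move=> v _ /=; rewrite [F v in RHS]matrix_sum_delta (big_morph f fD f0).
  apply: eq_bigr => i _; rewrite (big_morph f fD f0).
  by apply: eq_bigr => j _; rewrite fZ.
apply: affine_regular_sum => // i; apply: affine_regular_sum => // j.
by apply: affine_regularM => //; exact: affine_regular_const.
Qed.

Lemma regular_pair_morphism_on (p : nat) (F G : V -> 'M[k]_p) :
  regular_mx O F -> regular_mx O G ->
  morphism_on (X := affine V) (Y := affine ('M[k]_p * 'M[k]_p)%type) O
    (fun v => (F v, G v)).
Proof.
move=> rF rG; apply: regular_morphism_on => // f fS.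
pose f1 w := f (w, 0); pose f2 w := f (0, w).
have f1S : scalar f1.
  by move=> a u w; rewrite /f1 -fS; congr f; congr pair; rewrite /= scaler0 addr0.
have f2S : scalar f2.
  by move=> a u w; rewrite /f2 -fS; congr f; congr pair; rewrite /= scaler0 addr0.
apply: (@affine_regular_ext _ _ _ (fun v => f1 (F v) + f2 (G v))) => [v _|].
  rewrite /f1 /f2 -[f (F v, 0)]mul1r -fS /=; congr f; congr pair.
    by rewrite /= scale1r addr0.
  by rewrite /= scaler0 add0r.
by apply: affine_regularD; apply: regular_scalar_mx.
Qed.

End RegularMatrixMaps.

Lemma regular_mx_id (k : fieldType) (p q : nat) (O : set 'M[k]_(p, q)) :
  affine_open O -> regular_mx O id.
Proof.
by move=> oO i j; apply: affine_regular_linear => // a u v; rewrite !mxE.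
Qed.

(** * A chart of the flag variety around the flag of [g0] *)

Section Chart.
Variables (k : fieldType) (m n : nat).
Hypothesis le_nm : (n <= m)%N.
Variables (g0 x : 'M[k]_m).
Hypothesis g0U : g0 \in unitmx.
Implicit Types A : 'M[k]_(m, n).

Definition chart_domain : set 'M[k]_(m, n) :=
  [set A | reducible_frame le_nm (invmx g0 *m A)].

(** A rational local section from flags to invertible matrices: the frame is reduced in the basis
    [g0], completed, and carried back. By [chart_mul] it is invariant under invertible upper
    triangular column operations. *)
Definition chart A : 'M[k]_m :=
  g0 *m square_completion (invmx g0 *m A *m reduction le_nm (invmx g0 *m A)).

Lemma regular_truncate O j : affine_open O ->
  regular_mx O (fun A => truncate j (first_rows le_nm (invmx g0 *m A))).
Proof.
move=> oO a b; case E : ((a <= j)%N && (b <= j)%N).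
  apply: (@affine_regular_ext _ _ _ (fun A => (invmx g0 *m A) (widen_ord le_nm a) b)).
    by move=> A _; rewrite [RHS]mxE E [RHS]mxE.
  by apply: regular_mxM => //; [exact: regular_mx_const|exact: regular_mx_id].
apply: (@affine_regular_ext _ _ _ (fun=> (a == b)%:R)); last exact: affine_regular_const.
by move=> A _; rewrite [RHS]mxE E.
Qed.

Lemma chart_domain_open : affine_open chart_domain.
Proof.
have -> : chart_domain = [set A | setT A /\
    \prod_j \det (truncate j (first_rows le_nm (invmx g0 *m A))) != 0].
  apply/seteqP; split=> A /=.
    move=> AR; split=> //; apply/prodf_neq0 => j _.
    by rewrite -unitfE -unitmxE.
  by case=> _ /prodf_neq0 H j; rewrite unitmxE unitfE; apply: H.
apply: affine_open_neq0; first exact: affine_openT.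
apply: affine_regular_prod => [|j]; first exact: affine_openT.
by apply: regular_det; [|apply: regular_truncate]; exact: affine_openT.
Qed.

Lemma chart_unit A : chart_domain A -> chart A \in unitmx.
Proof. by move=> AR; rewrite unitmx_mul g0U square_completion_unit. Qed.

Lemma regular_chart : regular_mx chart_domain chart.
Proof.
have oD := chart_domain_open; pose gA A := invmx g0 *m A.
have rgA : regular_mx chart_domain gA.
  by apply: regular_mxM => //; [exact: regular_mx_const|exact: regular_mx_id].
apply: regular_mxM => //; first exact: regular_mx_const.
have rR : regular_mx chart_domain (fun A => reduction le_nm (gA A)).
  move=> a j; apply: (@affine_regular_ext _ _ _ (fun A =>
    (invmx (truncate j (first_rows le_nm (gA A))) *m delta_mx j 0 : 'cV[k]_n) a 0)).
    by move=> A _; rewrite [RHS]mxE.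
  apply: regular_mxM => //; last exact: regular_mx_const.
  by apply: regular_invmx => //; exact: regular_truncate.
move=> a c; case: (insubP 'I_n (val c)) => [j _ jE|nc].
  apply: (@affine_regular_ext _ _ _ (fun A => (gA A *m reduction le_nm (gA A)) a j)).
    move=> A _; rewrite [RHS]mxE; case: insubP => [j' _ j'E|]; last by rewrite -jE ltn_ord.
    by congr (_ a _); apply: val_inj; rewrite jE j'E.
  exact: regular_mxM.
apply: (@affine_regular_ext _ _ _ (fun=> (a == c)%:R)); last exact: affine_regular_const.
by move=> A _; rewrite [RHS]mxE insubN.
Qed.

Lemma chart_mul A b : upper_triangular b -> b \in unitmx -> chart_domain A ->
  chart (A *m b) = chart A.
Proof. by move=> bU bI AR; rewrite /chart mulmxA reduced_mul. Qed.

Lemma chart_columns A : first_columns le_nm (chart A) =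
  A *m reduction le_nm (invmx g0 *m A).
Proof. by rewrite first_columns_mul first_columns_square -mulmxA mulKVmx. Qed.

Lemma chart_flag (A B : @frames k m n) : chart_domain (val A) ->
  val B = first_columns le_nm (chart (val A)) -> flag_of B = flag_of A.
Proof.
move=> AR BE; apply: (flag_of_mul (reduction_upper AR)).
by rewrite BE chart_columns.
Qed.

Definition chart_pair A : 'M[k]_m * 'M[k]_m := (chart A, Ad (invmx (chart A)) x).

Lemma chart_pair_morphism_on :
  morphism_on (X := affine 'M[k]_(m, n)) (Y := affine ('M[k]_m * 'M[k]_m)%type)
    chart_domain chart_pair.
Proof.
have oD := chart_domain_open; apply: regular_pair_morphism_on => //.
  exact: regular_chart.
have rV : regular_mx chart_domain (fun A => invmx (chart A)).
  apply: regular_invmx => //; [exact: regular_chart|exact: chart_unit].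
apply: (regular_mxM (F := fun A => invmx (chart A) *m x)
  (G := fun A => invmx (invmx (chart A)))) => //.
  by apply: regular_mxM => //; exact: regular_mx_const.
by move=> i j; apply: affine_regular_ext (regular_chart i j) => A _; rewrite invmxK.
Qed.

Definition flag_chart_domain : set (@flags k m n) :=
  [set F | forall A : @frames k m n, flag_of A = F -> chart_domain (val A)].

Lemma flag_chart_domainE (A : @frames k m n) :
  flag_chart_domain (flag_of A) <-> chart_domain (val A).
Proof.
split=> [/(_ A erefl)//|AR B /flag_of_eq [b [bU bI ->]]].
by rewrite /chart_domain /= mulmxA; exact: reducible_frame_mul.
Qed.

Lemma flag_chart_domain_open : zopen (s := flags_space k m n) flag_chart_domain.
Proof.
exists chart_domain; first exact: chart_domain_open.
by apply/seteqP; split=> A /flag_chart_domainE.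
Qed.

Lemma flag_chart_domain_center (A : @frames k m n) :
  val A = first_columns le_nm g0 -> flag_chart_domain (flag_of A).
Proof.
move=> AE; apply/flag_chart_domainE => j; rewrite AE -first_columns_mul mulVmx //.
have -> : first_rows le_nm (first_columns le_nm 1%:M) = 1%:M :> 'M[k]_n.
  by apply/matrixP => a b; rewrite !mxE -!val_eqE.
by rewrite truncate1 unitmx1.
Qed.

Definition frame_of (F : @flags k m n) : @frames k m n := sval (cid (flag_of_surj F)).

Lemma frame_ofK F : flag_of (frame_of F) = F.
Proof. exact: svalP (cid (flag_of_surj F)). Qed.

(** Although [frame_of] is an arbitrary choice, [chart_pair] is constant on the frames of one flag
    in the domain. Pulled back to frames, the map is therefore [chart_pair] itself, which is
    regular. *)
Lemma flag_chart_pair_morphism_on :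
  morphism_on (X := flags_space k m n) (Y := affine ('M[k]_m * 'M[k]_m)%type)
    flag_chart_domain (fun F => chart_pair (val (frame_of F))).
Proof.
apply: morphism_on_quotient.
have -> : (@flag_of k m n) @^-1` flag_chart_domain = val @^-1` chart_domain.
  by apply/seteqP; split=> A /flag_chart_domainE.
apply: (@morphism_on_ext k (frames_space k m n) (affine ('M[k]_m * 'M[k]_m)%type) _
  (chart_pair \o val)).
- exact/subspace_sheaf_like/affine_sheaf_like.
- move=> A AD /=; rewrite /chart_pair.
  have [b [bU bI ->]] := flag_of_eq (frame_ofK (flag_of A)).
  by rewrite chart_mul.
- exact: (@morphism_on_subspace _ (affine _)) chart_pair_morphism_on.
Qed.

End Chart.

(** * The fiber and the flag variety are isomorphic *)

Section Isomorphism.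
Variables (k : numFieldType) (n K e q : nat).
Hypothesis le_nK : (n <= K)%N.
Local Notation m := (\sum_(i < n.+1) alpha n K i)%N.
Local Notation prs := (@pairs k n.+1 (alpha n K)).
Local Notation tw := (twisted k (alpha n K)).
Local Notation le_nm := (le_n_sum_alpha le_nK).
Variable t_ : forall i : 'I_n.+1, 'M[k]_(alpha n K i).
Hypothesis t_nilpotent : nilpotent (\mxdiag_i t_ i).
Hypothesis last_size : alpha n K ord_max = (e * q)%N.
Hypothesis last_type : jordan_type (t_ ord_max) (nseq q e).
Variable x : 'M[k]_m.
Hypothesis x_nilpotent : nilpotent x.
Local Notation fiber := (springer_fiber (\mxdiag_i t_ i) x).
Local Notation delta := (@delta_springer k m n e x).

Lemma fiberP (a : prs) : fiber (\pi_tw a) <->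
  Ad (val a).1 (val a).2 = x /\ delta (flag_of (pair_frame le_nK a)).
Proof.
have aU := pair_unit a; have aB := pair_upper a.
have cP := closure_orbitP le_nK t_nilpotent last_size last_type a.
have iP := pair_image_flagP le_nK a e.
have sP := stable_flagP (Ad (val a).1 (val a).2) aU (pair_frameE le_nK a).
rewrite AdK // in sP; split.
  case=> /cP ze; rewrite /= xi_pi => xE; split=> //; rewrite -xE.
  by split; [exact/sP|exact/iP].
case=> xE; rewrite -{1}xE => -[_ /iP/cP ?].
by split; rewrite //= xi_pi xE.
Qed.

(** Any completion [g] of a frame of the flag lifts it to a point over [x]: stability makes the
    conjugate of [x] block upper triangular, and its nilpotency places it in [N_L + n]. *)
Lemma flag_pair (g : 'M[k]_m) (A : @frames k m n) : g \in unitmx ->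
  val A = first_columns le_nm g -> delta (flag_of A) ->
  exists a : prs, [/\ val a = (g, Ad (invmx g) x), flag_of (pair_frame le_nK a) = flag_of A
    & Ad (val a).1 (val a).2 = x].
Proof.
move=> gU AE [/(stable_flagP x gU AE) zU _].
have aP : prs (g, Ad (invmx g) x).
  split=> //=; apply: nilpotent_plus_nilradical => //.
  by have [f xf] := x_nilpotent; exists f; rewrite Ad_exp ?unitmx_inv // xf Ad0.
exists (SigSub (mem_set aP)); split=> //; last by rewrite /= AdKV.
by congr flag_of; apply: val_inj; rewrite /= AE.
Qed.

Lemma springer_fiber_isomorphic : isomorphic
  (subspace (twisted_space k (alpha n K)) fiber)
  (subspace (flags_space k m n) delta).
Proof.
have sA V := @affine_sheaf_like k V.
have sP : sheaf_like (pairs_space k (alpha n K)) by exact: subspace_sheaf_like.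
have sT : sheaf_like (twisted_space k (alpha n K)) by exact: quotient_sheaf_like.
have sF : sheaf_like (flags_space k m n) by exact/quotient_sheaf_like/subspace_sheaf_like.
have fP (c : fiber) : delta (twisted_flag le_nK (val c)).
  have := set_valP c; rewrite -{1}[val c]reprK => /fiberP[_].
  by rewrite /twisted_flag.
pose f (c : fiber) : delta := SigSub (mem_set (fP c)).
(* The inverse is first defined by arbitrary lifts; its class in the quotient is determined by the
   flag and [x]. *)
have rP (F : delta) : exists a : prs,
    flag_of (pair_frame le_nK a) = val F /\ Ad (val a).1 (val a).2 = x.
  have [A AF] := flag_of_surj (val F); have [g gU gA] := complete_frame le_nm A.
  have [|a [_ aF ax]] := flag_pair gU (esym gA); first by rewrite AF; exact: set_valP.
  by exists a; rewrite aF AF.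
have [rep repP] := choice rP.
have gP (F : delta) : fiber (\pi_tw (rep F)).
  by have [aF ax] := repP F; apply/fiberP; rewrite aF; split=> //; exact: set_valP.
pose g (F : delta) : fiber := SigSub (mem_set (gP F)).
exists f, g; split.
- move=> c; apply: val_inj; rewrite /= -[RHS]reprK.
  have [aF ax] := repP (f c).
  have := set_valP c; rewrite -{1}[val c]reprK => /fiberP[cx _].
  by apply: (@pi_twisted_eq _ _ _ le_nK); rewrite ?aF // ax cx.
- move=> F; apply: val_inj.
  exact: etrans (twisted_flag_pi le_nK (rep F)) (repP F).1.
(* Before passing to quotients, the map to flags is the linear map that keeps the first [n] columns
   of [g]. *)
- apply/morphism_onT; apply: morphism_on_into_subspace; first exact: subspace_sheaf_like.
  rewrite (_ : val \o f = twisted_flag le_nK \o val) //.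
  apply: (@morphism_on_subspace _ _ _ _ setT).
  apply: morphism_on_quotient.
  rewrite (_ : _ \o _ = @flag_of k m n \o pair_frame le_nK); last first.
    by apply/funext => a; exact: twisted_flag_pi.
  apply: (@morphism_on_comp _ _ (frames_space k m n) (flags_space k m n)); last first.
    exact: quotient_map_morphism.
  apply: morphism_on_into_subspace => //.
  pose col1 (gz : 'M[k]_m * 'M[k]_m) := first_columns le_nm gz.1.
  apply: (@morphism_on_subspace _ (affine _) (affine _) _ setT col1).
  apply: regular_morphism_on => [|h hS]; first exact: affine_openT.
  apply: affine_regular_linear => [|a u v]; first exact: affine_openT.
  by rewrite /= -hS; congr h; apply/matrixP => i j; rewrite !mxE.
(* Regularity of the inverse is local, so each flag [F0] gets the chart centered at a basis [g0]
   adapted to it. *)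
- apply/morphism_onT; apply: morphism_on_into_subspace; first exact: subspace_sheaf_like.
  apply/morphism_onT; apply: morphism_local; first exact: subspace_sheaf_like.
  move=> F0; have [A0 A0F] := flag_of_surj (val F0).
  have [g0 g0U g0A] := complete_frame le_nm A0.
  pose D := flag_chart_domain le_nm g0.
  pose psi F := chart_pair le_nm g0 x (val (frame_of F)).
  exists (val @^-1` D); split.
  + by exists D => //; exact: flag_chart_domain_open.
  + by rewrite /= -A0F; apply: flag_chart_domain_center; rewrite ?g0A.
  have gamP (F : delta) : exists a : prs, [/\ flag_of (pair_frame le_nK a) = val F,
      Ad (val a).1 (val a).2 = x & D (val F) -> val a = psi (val F)].
    have [DF|nDF] := pselect (D (val F)); last first.
      by have [a [aF ax]] := rP F; exists a; split.
    have DA : chart_domain le_nm g0 (val (frame_of (val F))).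
      by apply/flag_chart_domainE; rewrite frame_ofK.
    have cU := chart_unit g0U DA.
    pose B : @frames k m n := SigSub (mem_set (first_columns_frame le_nm cU)).
    have BF : flag_of B = val F by rewrite (chart_flag g0U DA) ?frame_ofK.
    have [|a [aE aF ax]] := flag_pair cU (erefl _ : val B = _).
      by rewrite BF; exact: set_valP.
    by exists a; rewrite aF BF.
  have [gam gam_spec] := choice gamP.
  rewrite (_ : val \o g = (fun a : prs => \pi_tw a) \o gam); last first.
    apply/funext => F; have [aF ax _] := gam_spec F; have [bF bx] := repP F.
    by apply: (@pi_twisted_eq _ _ _ le_nK); rewrite ?aF ?bF ?ax ?bx.
  apply: (@morphism_on_comp _ _ (pairs_space k (alpha n K)) (twisted_space k (alpha n K)));
    last exact: quotient_map_morphism.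
  apply: morphism_on_into_subspace; first exact: subspace_sheaf_like.
  apply: (@morphism_on_ext _ (subspace (flags_space k m n) delta) (affine _) _ (psi \o val)).
  + exact: subspace_sheaf_like.
  + by move=> F DF; have [_ _ /(_ DF)] := gam_spec F.
  + apply: (@morphism_on_subspace _ (flags_space k m n) (affine _)).
    exact: flag_chart_pair_morphism_on.
Qed.

End Isomorphism.

Theorem lemma3p3 (R : realType) (n s : nat) (lambda : seq nat) (k K : nat)
  (n_ge1 : (1 <= n)%N) (s_ge1 : (1 <= s)%N)
  (lambda_partition : is_partition lambda)
  (kE : k = sumn lambda) (k_le_n : (k <= n)%N)
  (length_lambda : (size lambda <= s)%N)
  (KE : K = sumn (Lambda n s lambda))
  (x : 'M[R[i]]_(\sum_(i < n.+1) alpha n K i))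
  (x_nilpotent : nilpotent x)
  (x_type : jordan_type x (Lambda n s lambda))
  (t_ : forall i : 'I_n.+1, 'M[R[i]]_(alpha n K i))
  (t_nilpotent : nilpotent (\mxdiag_i t_ i))
  (t_type1 : forall i : 'I_n.+1, (i < n)%N -> jordan_type (t_ i) [:: 1%N])
  (t_type2 : jordan_type (t_ ord_max) (nseq (s - 1) (n - k)%N)) :
  isomorphic
    (subspace (twisted_space R[i] (alpha n K)) (springer_fiber (\mxdiag_i t_ i) x))
    (subspace (flags_space R[i] (\sum_(i < n.+1) alpha n K i) n)
       (delta_springer n (n - k) x)).
Proof.
have K_E : K = (n + (n - k) * (s - 1))%N by rewrite KE sumn_Lambda -?kE.
(* The last block has size [K - n = (n - k) * (s - 1)], so the exponent is [n - k] and there are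
   [s - 1] Jordan blocks. *)
apply: (springer_fiber_isomorphic (q := s - 1)) => //.
  by rewrite K_E leq_addr.
by rewrite /alpha ltnn K_E addKn.
Qed.
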